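(* Let $X$ be a locally path-connected metrizable space with $X\in AP(n,0)$. Then every point $x\in X$ is a homological $Z_{n-1}$-point in $X$, i.e., $H_k(U,U\setminus\{x\})=0$ for every open set $U\subset X$ and every $k<n$.
   Context: $H_*$ denotes relative singular homology with integer coefficients. A map is $0$-dimensional if all fibers have covering dimension $\le0$. For a compatible metric on $X$ and $\varepsilon>0$, maps $g,g'\colon\mathbb I^n\to X$ are $\varepsilon$-homotopic if there is a homotopy $h\colon\mathbb I^n\times[0,1]\to X$ from $g$ to $g'$ with $\mathrm{diam}\,h(\{z\}\times[0,1])<\varepsilon$ for all $z$. $X\in AP(n,0)$ means: for every $\varepsilon>0$ and map $g\colon\mathbb I^n\to X$ there is a $0$-dimensional map $g'\colon\mathbb I^n\to X$ $\varepsilon$-homotopic to $g$. *)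

(* Defs.v *)
From HB Require Import structures.
From mathcomp Require Import all_boot all_order all_algebra.
From mathcomp Require Import all_classical all_reals all_analysis.
Set Implicit Arguments. Unset Strict Implicit. Unset Printing Implicit Defensive.
Import Order.TTheory GRing.Theory Num.Theory.
Import numFieldNormedType.Exports.
Local Open Scope classical_set_scope.
Local Open Scope ring_scope.

Section defs.
Variable R : realType.

Definition path_connected_set (T : topologicalType) (W : set T) :=
  forall a b, W a -> W b -> exists p : R -> T,
    [/\ {within `[0, 1], continuous p}, p 0 = a, p 1 = b &
        p @` `[0, 1] `<=` W].

Definition locally_path_connected (T : topologicalType) :=
  forall (x : T) (N : set T), nbhs x N ->
    exists W : set T, [/\ open W, W x, W `<=` N & path_connected_set W].

Definition cdim_le0 (T : topologicalType) (A : set T) :=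
  forall Us : seq (set T), (forall U, U \in Us -> open U) ->
    A `<=` \bigcup_(U in [set U | U \in Us]) U ->
    exists Vs : seq (set T),
      [/\ forall V, V \in Vs -> open V,
          forall V, V \in Vs -> exists2 U, U \in Us & V `<=` U,
          A `<=` \bigcup_(V in [set V | V \in Vs]) V &
          forall i j, (i < size Vs)%N -> (j < size Vs)%N -> i <> j ->
            nth set0 Vs i `&` nth set0 Vs j `&` A = set0].

Definition unit_cube (n : nat) : set 'rV[R]_n :=
  [set z | forall i, 0 <= z ord0 i <= 1].
Arguments unit_cube : clear implicits.

Definition zero_dim_map (X : topologicalType) n (g : 'rV[R]_n -> X) :=
  forall y : X, cdim_le0 ((unit_cube n) `&` (g @^-1` [set y])).

Definition diam_lt (X : metricType R) (A : set X) (eps : R) :=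
  exists2 d : R, d < eps & forall a b, A a -> A b -> mdist a b <= d.

Definition eps_homotopic (X : metricType R) n (eps : R)
    (g g' : 'rV[R]_n -> X) :=
  exists h : 'rV[R]_n * R -> X,
    [/\ {within unit_cube n `*` `[0, 1], continuous h},
        forall z, unit_cube n z -> h (z, 0) = g z,
        forall z, unit_cube n z -> h (z, 1) = g' z &
        forall z, unit_cube n z -> diam_lt [set h (z, t) | t in `[0, 1]] eps].

Definition AP_n0 (X : metricType R) (n : nat) :=
  forall (eps : R) (g : 'rV[R]_n -> X), 0 < eps ->
    {within unit_cube n, continuous g} ->
    exists g' : 'rV[R]_n -> X,
      [/\ {within unit_cube n, continuous g'}, zero_dim_map g' &
          eps_homotopic eps g g'].

Definition stdsimplex (k : nat) : set 'rV[R]_k.+1 :=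
  [set t | (forall i, 0 <= t ord0 i) /\ \sum_i t ord0 i = 1].
Arguments stdsimplex : clear implicits.

Definition sing_in (X : topologicalType) (A : set X) k (s : 'rV[R]_k.+1 -> X) :=
  {within stdsimplex k, continuous s} /\ s @` stdsimplex k `<=` A.

Definition chain (X : topologicalType) (k : nat) := seq (int * ('rV[R]_k.+1 -> X)).

Definition chain_in (X : topologicalType) (A : set X) k (c : chain X k) :=
  all (fun p => `[< sing_in A p.2 >]) c.

(* coefficient of the singular simplex s in c (simplices are identified
   when they agree on the standard simplex) *)
Definition coef (X : topologicalType) k (c : chain X k) (s : 'rV[R]_k.+1 -> X) : int :=
  \sum_(p <- c | `[< forall t, stdsimplex k t -> p.2 t = s t >]) p.1.

Definition chain_eqv (X : topologicalType) k (c d : chain X k) :=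
  forall s, coef c s = coef d s.

Definition face_map k (i : 'I_k.+2) (t : 'rV[R]_k.+1) : 'rV[R]_k.+2 :=
  \row_(j < k.+2) (if (j < i)%N then t ord0 (inord j)
                   else if j == i :> nat then 0 else t ord0 (inord j.-1)).

Definition boundary (X : topologicalType) k (c : chain X k.+1) : chain X k :=
  flatten [seq [seq (((-1) ^+ i * p.1)%R, p.2 \o face_map i) | i : 'I_k.+2 <- enum 'I_k.+2]
          | p : int * ('rV[R]_k.+2 -> X) <- c].

(* relative cycle of (U, A): boundary lies in A (automatic for k = 0) *)
Definition rel_cycle (X : topologicalType) (A : set X) (k : nat) : chain X k -> Prop :=
  match k with
  | 0 => fun _ => True
  | k'.+1 => fun c => exists2 e : chain X k', chain_in A e & chain_eqv (boundary c) e
  end.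

Definition rel_homology_trivial (X : topologicalType) (U A : set X) (k : nat) :=
  forall c : chain X k, chain_in U c -> rel_cycle A c ->
    exists (d : chain X k.+1) (a : chain X k),
      [/\ chain_in U d, chain_in A a & chain_eqv c (boundary d ++ a)].

End defs.

(* Main.v *)
Require Import Defs.
From mathcomp.multinomials Require Import freeg.
From HB Require Import structures.
From mathcomp Require Import all_boot all_order all_algebra.
From mathcomp Require Import all_classical all_reals all_analysis.
From mathcomp Require Import zify ring lra.
Import Order.TTheory GRing.Theory Num.Theory.
Import numFieldNormedType.Exports.
Set Implicit Arguments.
Unset Strict Implicit.
Unset Printing Implicit Defensive.
Local Open Scope classical_set_scope.
Local Open Scope ring_scope.

(* Fix [x] in the open set [U], and put [V := U x R] and [W := V minus (x, 0)].
   A map [(f, u)] from a cube of dimension at most [n] to [V] can be pushed into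
   [W]: approximate [f] by a 0-dimensional map, then move [u] away from [0] on
   the 0-dimensional compact preimage of [x].  Doing this by homotopies, face by
   face, yields a chain map [r] from the singular chains of [V] to those of [W]
   in degrees [<= n] which fixes the chains of [W].
   Let [c] be a [k]-cycle of [(U, U minus x)], [k < n].  Applying [r] to the chain
   [c x [-1/2, 1/2]] gives a chain of [W] with the same boundary modulo
   [(U minus x) x R].  Its fine subdivisions split into simplices on which
   [u > 0], [u < 0] or [f <> x]; the projection to [U] of the part [u > 0] shows
   that the subdivided [c], hence [c], bounds modulo [U minus x]. *)

(** A 0-dimensional map may still hit [x], so approximation alone cannot clear [x] from a simplex of
    [U]. The factor [R] gives the missing room: a compact fiber of dimension 0 splits into two
    closed pieces, one where [u] is small and can be shifted by a larger amount, one where [u] is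
    already nonzero. The price is one dimension, since the product with an interval turns a
    [k]-chain into a [k.+1]-chain; this is where [k < n] enters. The obstacle is compatibility with
    faces: the homotopies given by AP also move the boundary of a simplex, where the motion is
    already prescribed. They are therefore slowed down to rest at the boundary. The points stopped
    halfway are harmless: if the boundary avoids [(x, 0)], then by compactness [f] is far from [x]
    or [u] is far from [0] in a whole collar, with a margin known before [f] is approximated. The
    final splitting works as an excision because the parts [u > 0] and [u < 0] are disjoint:
    whatever the boundary of the positive part shares with the rest must avoid [x]. *)

Section FreeAbelian.
Variable K : choiceType.

(** * Free abelian groups, linear extension, supports *)

Definition gen (x : K) : {freeg K} := << x >>.

Section Lift.
Variables (M : lmodType int) (f : K -> M).

Definition flift : {freeg K} -> M := fglift f.

Lemma flift_is_additive : {morph flift : x y / x - y}.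
Proof. exact: lift_is_additive. Qed.

HB.instance Definition _ :=
  GRing.isZmodMorphism.Build {freeg K} M flift flift_is_additive.

Lemma flift_gen x : flift (gen x) = f x.
Proof. by rewrite /flift /gen liftU scale1r. Qed.

End Lift.

(** Inductive, so that statements about linear maps are proved on generators. The description by
    coefficients is recovered in [supp_dom]. *)
Inductive supp (P : K -> Prop) : {freeg K} -> Prop :=
| supp0 : supp P 0
| supp_gen x : P x -> supp P (gen x)
| suppD x y : supp P x -> supp P y -> supp P (x + y)
| suppN x : supp P x -> supp P (- x).

Lemma suppMz P x (n : int) : supp P x -> supp P (x *~ n).
Proof.
move=> Px; have Pn m : supp P (x *+ m).
  by elim: m => [|m IH]; [rewrite mulr0n; exact: supp0|rewrite mulrS; exact: suppD].
by case: n => m; [exact: Pn|apply: suppN; exact: Pn].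
Qed.

Lemma supp_sum P (I : Type) (r : seq I) (Q : pred I) (F : I -> {freeg K}) :
  (forall i, Q i -> supp P (F i)) -> supp P (\sum_(i <- r | Q i) F i).
Proof.
move=> PF; elim/big_ind : _ => //; [exact: supp0|exact: suppD].
Qed.

Lemma supp_true x : supp (fun=> True) x.
Proof.
elim/freeg_ind_dom0 : x => [|k x D _ _ IH]; first exact: supp0.
apply: suppD => //.
by rewrite -[k]intz -freegU_mulz; apply: suppMz; exact: supp_gen.
Qed.

Lemma free_ind (P : {freeg K} -> Prop) :
  P 0 -> (forall w, P (gen w)) -> (forall x y, P x -> P y -> P (x + y)) ->
  (forall x, P x -> P (- x)) -> forall x, P x.
Proof.
by move=> P0 Pg PD PN x; elim: {x}(supp_true x) => // *; [exact: PD|exact: PN].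
Qed.

End FreeAbelian.

(** * Affine chains: cones, barycentric subdivision, cylinders *)

Section AffineChains.
Variable R : realType.

(* The rows of a matrix are the vertices of an affine simplex, parametrized by
   [t |-> t *m w].  The complex is augmented: [aff d 0] is generated by the empty
   simplex. *)
Definition aff (d n : nat) := {freeg 'M[R]_(n, d)}.

Definition aff_bd d n : aff d n.+1 -> aff d n :=
  flift (fun w => \sum_(i < n.+1) gen (row' i w) *~ ((-1) ^+ i)).

HB.instance Definition _ d n := GRing.Additive.on (@aff_bd d n).

Definition cone d n (b : 'rV[R]_d) : aff d n -> aff d n.+1 :=
  flift (fun w => gen (col_mx b w : 'M[R]_(n.+1, d))).

HB.instance Definition _ d n b := GRing.Additive.on (@cone d n b).

Lemma col_mx0E d n (b : 'rV[R]_d) (w : 'M[R]_(n, d)) j :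
  (col_mx b w : 'M[R]_(n.+1, d)) ord0 j = b ord0 j.
Proof. by rewrite mxE; case: splitP => // k _; rewrite ord1. Qed.

Lemma col_mx_liftE d n (b : 'rV[R]_d) (w : 'M[R]_(n, d)) i j :
  (col_mx b w : 'M[R]_(n.+1, d)) (lift ord0 i) j = w i j.
Proof.
rewrite mxE; case: splitP => k; first by case: k => -[].
by case=> ik; congr (w _ _); exact: val_inj.
Qed.

Lemma gen_cone d n (w : 'M[R]_(n.+1, d)) :
  gen w = cone (row ord0 w) (gen (row' ord0 w)).
Proof.
rewrite /cone flift_gen; congr gen; apply/matrixP => i j.
case: (unliftP ord0 i) => [k ->|->]; first by rewrite col_mx_liftE mxE.
by rewrite col_mx0E mxE.
Qed.

Lemma bd_cone d n (b : 'rV[R]_d) (x : aff d n.+1) :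
  aff_bd (cone b x) = x - cone b (aff_bd x).
Proof.
elim/free_ind: x => [|w|x y IHx IHy|x IHx]; last 1 first.
- by rewrite !raddfN/= IHx opprB addrC opprK.
- by rewrite !raddf0 ?addr0.
- rewrite /cone flift_gen {1 2}/aff_bd !flift_gen big_ord_recl/= mulr1z.
  congr (gen _ + _).
    by apply/matrixP => i j; rewrite [LHS]mxE col_mx_liftE.
  rewrite raddf_sum/= -sumrN; apply: eq_bigr => i _.
  rewrite raddfMz/= flift_gen exprS mulN1r mulrNz; congr (- (gen _ *~ _)).
  apply/matrixP => k j; rewrite [LHS]mxE.
  case: (unliftP ord0 k) => [l ->|->].
    rewrite col_mx_liftE [RHS]mxE (_ : lift _ (lift _ _) = lift ord0 (lift i l)).
      by rewrite col_mx_liftE.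
    apply: val_inj; exact: bumpS.
  by rewrite col_mx0E (_ : lift _ _ = ord0) ?col_mx0E//; exact: val_inj.
- by rewrite !raddfD/= IHx IHy addrACA -opprD.
Qed.

(** The boundary of a vertex is the empty simplex of the augmented complex; nothing lies below it,
    hence no correction term as in [bd_cone]. *)
Lemma bd_cone0 d (b : 'rV[R]_d) (x : aff d 0) : aff_bd (cone b x) = x.
Proof.
elim/free_ind: x => [|w|x y IHx IHy|x IHx].
- by rewrite !raddf0.
- rewrite /cone flift_gen /aff_bd !flift_gen big_ord1/= mulr1z.
  by congr gen; apply/matrixP => -[].
- by rewrite !raddfD/= IHx IHy.
- by rewrite !raddfN/= IHx.
Qed.

(** Every simplex is the cone on the face opposite its first vertex, so the cone formula reduces the
    claim to one dimension lower. *)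
Lemma bdK d n (x : aff d n.+2) : aff_bd (aff_bd x) = 0.
Proof.
elim: n x => [|n IH]; elim/free_ind => [|w|x y Hx Hy|x Hx];
  rewrite ?raddf0// ?raddfD ?raddfN/= ?Hx ?Hy ?addr0 ?oppr0//.
  by rewrite gen_cone bd_cone raddfB/= bd_cone0 subrr.
by rewrite gen_cone bd_cone raddfB/= bd_cone IH raddf0 subr0 subrr.
Qed.

Definition push d d' n (a : 'M[R]_(d, d')) : aff d n -> aff d' n :=
  flift (fun w => gen (w *m a)).

HB.instance Definition _ d d' n a := GRing.Additive.on (@push d d' n a).

Lemma push_cone d d' n (a : 'M[R]_(d, d')) b (x : aff d n) :
  push a (cone b x) = cone (b *m a) (push a x).
Proof.
elim/free_ind: x => [|w|x y Hx Hy|x Hx];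
  rewrite ?raddf0// ?raddfD ?raddfN/= ?Hx ?Hy//.
by rewrite /push /cone !flift_gen; congr gen; exact: (@mul_col_mx _ 1 n d d' b w a).
Qed.

Lemma push_bd d d' n (a : 'M[R]_(d, d')) (x : aff d n.+1) :
  push a (aff_bd x) = aff_bd (push a x).
Proof.
elim/free_ind: x => [|w|x y Hx Hy|x Hx];
  rewrite ?raddf0// ?raddfD ?raddfN/= ?Hx ?Hy//.
rewrite /push /aff_bd !flift_gen raddf_sum/=; apply: eq_bigr => i _.
rewrite raddfMz/= flift_gen; congr (gen _ *~ _).
by apply/matrixP => k j; rewrite !mxE; apply: eq_bigr => l _; rewrite !mxE.
Qed.

Definition bary d n (w : 'M[R]_(n, d)) : 'rV[R]_d := const_mx n%:R^-1 *m w.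

Fixpoint sd1 d n : 'M[R]_(n, d) -> aff d n :=
  match n with
  | 0 => fun w => gen w
  | n'.+1 => fun w => cone (bary w) (flift (@sd1 d n') (aff_bd (gen w)))
  end.

Definition sd d n : aff d n -> aff d n := flift (@sd1 d n).

HB.instance Definition _ d n := GRing.Additive.on (@sd d n).

Lemma sd_gen d n (w : 'M[R]_(n.+1, d)) :
  sd (gen w) = cone (bary w) (sd (aff_bd (gen w))).
Proof. by rewrite {1}/sd flift_gen. Qed.

Lemma sd0 d (x : aff d 0) : sd x = x.
Proof.
elim/free_ind: x => [|w|x y Hx Hy|x Hx];
  rewrite ?raddf0// ?raddfD ?raddfN/= ?Hx ?Hy//.
by rewrite /sd flift_gen.
Qed.

(** The cone formula returns the subdivided boundary minus a cone on its own boundary, and the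
    latter vanishes by induction and [bdK]. *)
Lemma sd_bd d n (x : aff d n.+1) : sd (aff_bd x) = aff_bd (sd x).
Proof.
elim: n x => [|n IH]; elim/free_ind => [|w|x y Hx Hy|x Hx];
  rewrite ?raddf0// ?raddfD ?raddfN/= ?Hx ?Hy//.
  by rewrite sd_gen bd_cone0.
by rewrite sd_gen bd_cone -IH bdK raddf0 raddf0 subr0.
Qed.

Lemma sd_push d d' n (a : 'M[R]_(d, d')) (x : aff d n) :
  sd (push a x) = push a (sd x).
Proof.
elim: n x => [|n IH] x; first by rewrite !sd0.
elim/free_ind: x => [|w|x y Hx Hy|x Hx];
  rewrite ?raddf0// ?raddfD ?raddfN/= ?Hx ?Hy//.
rewrite [in LHS]/push flift_gen !sd_gen push_cone -IH push_bd.
by rewrite /push flift_gen /bary mulmxA.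
Qed.

Definition topmx d n (w : 'M[R]_(n, d)) : 'M[R]_(n, d + 1) :=
  row_mx w (const_mx 1).
Definition top d n : aff d n -> aff (d + 1) n := flift (fun w => gen (topmx w)).
HB.instance Definition _ d n := GRing.Additive.on (@top d n).

Definition botmx d n (w : 'M[R]_(n, d)) : 'M[R]_(n, d + 1) := row_mx w 0.
Definition bot d n : aff d n -> aff (d + 1) n := flift (fun w => gen (botmx w)).
HB.instance Definition _ d n := GRing.Additive.on (@bot d n).

Definition sdn N d n : aff d n -> aff d n := iter N (@sd d n).

Lemma sdn_is_additive N d n : {morph @sdn N d n : x y / x - y}.
Proof. by move=> x y; elim: N => //= N ->; rewrite raddfB. Qed.

HB.instance Definition _ N d n :=
  GRing.isZmodMorphism.Build _ _ (@sdn N d n) (@sdn_is_additive N d n).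

Lemma sdn_bd N d n (x : aff d n.+1) : sdn N (aff_bd x) = aff_bd (sdn N x).
Proof. by elim: N => //= N ->; rewrite sd_bd. Qed.

Lemma sdn_push N d d' n (a : 'M[R]_(d, d')) (x : aff d n) :
  sdn N (push a x) = push a (sdn N x).
Proof. by elim: N => //= N ->; rewrite sd_push. Qed.

Lemma sdn0 N d (x : aff d 0) : sdn N x = x.
Proof. by elim: N => //= N ->; rewrite sd0. Qed.

Lemma top_bd d n (x : aff d n.+1) : top (aff_bd x) = aff_bd (top x).
Proof.
elim/free_ind: x => [|w|x y Hx Hy|x Hx];
  rewrite ?raddf0// ?raddfD ?raddfN/= ?Hx ?Hy//.
rewrite /top /aff_bd !flift_gen raddf_sum/=; apply: eq_bigr => i _.
rewrite raddfMz/= flift_gen; congr (gen _ *~ _).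
by apply/matrixP => k j; rewrite !mxE; case: splitP => l _; rewrite !mxE.
Qed.

Lemma bot_bd d n (x : aff d n.+1) : bot (aff_bd x) = aff_bd (bot x).
Proof.
elim/free_ind: x => [|w|x y Hx Hy|x Hx];
  rewrite ?raddf0// ?raddfD ?raddfN/= ?Hx ?Hy//.
rewrite /bot /aff_bd !flift_gen raddf_sum/=; apply: eq_bigr => i _.
rewrite raddfMz/= flift_gen; congr (gen _ *~ _).
by apply/matrixP => k j; rewrite !mxE; case: splitP => l _; rewrite !mxE.
Qed.

(** The product of the linear map [a] with the identity of the height coordinate. *)
Definition cylmx d d' (a : 'M[R]_(d, d')) : 'M[R]_(d + 1, d' + 1) :=
  block_mx a 0 0 1%:M.

Lemma top_push d d' n (a : 'M[R]_(d, d')) (x : aff d n) :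
  top (push a x) = push (cylmx a) (top x).
Proof.
elim/free_ind: x => [|w|x y Hx Hy|x Hx];
  rewrite ?raddf0// ?raddfD ?raddfN/= ?Hx ?Hy//.
rewrite /top /push !flift_gen /topmx /cylmx mul_row_block.
by rewrite !mulmx0 addr0 add0r mulmx1.
Qed.

Lemma bot_push d d' n (a : 'M[R]_(d, d')) (x : aff d n) :
  bot (push a x) = push (cylmx a) (bot x).
Proof.
elim/free_ind: x => [|w|x y Hx Hy|x Hx];
  rewrite ?raddf0// ?raddfD ?raddfN/= ?Hx ?Hy//.
rewrite /bot /push !flift_gen /botmx /cylmx mul_row_block.
by rewrite !mulmx0 mul0mx !addr0.
Qed.

(* The chain homotopy between the inclusion of the top of the cylinder and the
   [N]-fold subdivision of its bottom, obtained by coning in the cylinder. *)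
Fixpoint cyl1 N d n : 'M[R]_(n, d) -> aff (d + 1) n.+1 :=
  match n with
  | 0 => fun w => 0
  | n'.+1 => fun w => cone (bary (topmx w))
      (top (gen w) - sdn N (bot (gen w)) - flift (@cyl1 N d n') (aff_bd (gen w)))
  end.

Definition cyl N d n : aff d n -> aff (d + 1) n.+1 := flift (@cyl1 N d n).
HB.instance Definition _ N d n := GRing.Additive.on (@cyl N d n).

Lemma cyl_gen N d n (w : 'M[R]_(n.+1, d)) :
  cyl N (gen w) = cone (bary (topmx w))
    (top (gen w) - sdn N (bot (gen w)) - cyl N (aff_bd (gen w))).
Proof. by rewrite {1}/cyl flift_gen. Qed.

Lemma cyl0 N d (x : aff d 0) : cyl N x = 0.
Proof.
elim/free_ind: x => [|w|x y Hx Hy|x Hx];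
  rewrite ?raddf0// ?raddfD ?raddfN/= ?Hx ?Hy ?addr0 ?oppr0//.
by rewrite /cyl flift_gen.
Qed.

(** The chain over which [cyl] cones is a cycle by induction, so the cone formula returns it
    unchanged. In the lowest degree this is the fact that top and bottom of the empty simplex
    coincide, there being no row to give a height to. *)
Lemma bd_cyl N d n (x : aff d n.+1) :
  aff_bd (cyl N x) = top x - sdn N (bot x) - cyl N (aff_bd x).
Proof.
have top0E (w : 'M[R]_(0, d)) : topmx w = botmx w.
  by apply/matrixP => -[].
elim: n x => [|n IH]; elim/free_ind => [|w|x y Hx Hy|x Hx].
- by rewrite !raddf0 ?addr0.
- rewrite cyl_gen bd_cone cyl0 subr0 raddfB/= -sdn_bd -top_bd -bot_bd sdn0.
  rewrite (_ : top _ = bot (aff_bd (gen w))) ?subrr ?raddf0 ?addr0 ?subr0//.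
  elim/free_ind: (aff_bd (gen w)) => [|w'|x y Hx Hy|x Hx];
    rewrite ?raddf0// ?raddfD ?raddfN/= ?Hx ?Hy//.
  by rewrite /top /bot !flift_gen; congr gen; exact: top0E.
- rewrite !raddfD/= Hx Hy; rewrite addrACA; congr (_ + _); exact: addrACA.
- rewrite [cyl N (- x)]raddfN [aff_bd (- cyl _ _)]raddfN/= Hx [top (- x)]raddfN.
  rewrite [bot (- x)]raddfN [sdn N (- _)]raddfN [aff_bd (- x)]raddfN.
  by rewrite [cyl N (- _)]raddfN/= !opprD.
- by rewrite !raddf0 ?addr0.
- have E : aff_bd (top (gen w) - sdn N (bot (gen w))) =
      top (aff_bd (gen w)) - sdn N (bot (aff_bd (gen w))).
    by rewrite raddfB/= -sdn_bd -top_bd -bot_bd.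
  rewrite cyl_gen bd_cone raddfB/= IH bdK E [cyl N 0]raddf0 subr0 subrr.
  by rewrite [cone _ 0]raddf0 subr0.
- rewrite !raddfD/= Hx Hy; rewrite addrACA; congr (_ + _); exact: addrACA.
- rewrite [cyl N (- x)]raddfN [aff_bd (- cyl _ _)]raddfN/= Hx [top (- x)]raddfN.
  rewrite [bot (- x)]raddfN [sdn N (- _)]raddfN [aff_bd (- x)]raddfN.
  by rewrite [cyl N (- _)]raddfN/= !opprD.
Qed.

Lemma cyl_push N d d' n (a : 'M[R]_(d, d')) (x : aff d n) :
  cyl N (push a x) = push (cylmx a) (cyl N x).
Proof.
elim: n x => [|n IH] x; first by rewrite !cyl0 raddf0.
elim/free_ind: x => [|w|x y Hx Hy|x Hx];
  rewrite ?raddf0// ?raddfD ?raddfN/= ?Hx ?Hy//.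
have pE : push a (gen w) = gen (w *m a) by rewrite /push flift_gen.
rewrite [in LHS]pE !cyl_gen push_cone 2!(raddfB (@push _ _ _ (cylmx a)))/=.
rewrite -IH push_bd -sdn_push -top_push -bot_push !pE; congr (cone _ _).
by rewrite /bary -mulmxA /topmx /cylmx mul_row_block !mulmx0 addr0 add0r mulmx1.
Qed.

End AffineChains.

Section SupportLemmas.
Variables K K' : choiceType.

Lemma supp_flift (P : K -> Prop) (Q : K' -> Prop) (f : K -> {freeg K'}) x :
  (forall k, P k -> supp Q (f k)) -> supp P x -> supp Q (flift f x).
Proof.
move=> fPQ; elim=> {x} [|k Pk|x y _ IHx _ IHy|x _ IHx].
- by rewrite raddf0; exact: supp0.
- by rewrite flift_gen; exact: fPQ.
- by rewrite raddfD; exact: suppD.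
- by rewrite raddfN; exact: suppN.
Qed.

Lemma suppB (P : K -> Prop) x y : supp P x -> supp P y -> supp P (x - y).
Proof. by move=> Px Py; apply: suppD => //; exact: suppN. Qed.

Lemma sub_supp (P Q : K -> Prop) x :
  (forall k, P k -> Q k) -> supp P x -> supp Q x.
Proof.
move=> PQ; elim=> {x} [|k Pk|x y _ IHx _ IHy|x _ IHx].
- exact: supp0.
- by apply: supp_gen; exact: PQ.
- exact: suppD.
- exact: suppN.
Qed.

Lemma eq_flift_supp (M : lmodType int) (P : K -> Prop) (f g : K -> M) x :
  (forall k, P k -> f k = g k) -> supp P x -> flift f x = flift g x.
Proof.
move=> fg; elim=> {x} [|k Pk|x y _ IHx _ IHy|x _ IHx].
- by rewrite !raddf0.
- by rewrite !flift_gen fg.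
- by rewrite !raddfD/= IHx IHy.
- by rewrite !raddfN/= IHx.
Qed.

End SupportLemmas.

(** * Convexity and the mesh of iterated subdivisions *)

Section Subdivision.
Variable R : realType.

Definition barycoord n (t : 'rV[R]_n) :=
  (forall i, 0 <= t ord0 i) /\ \sum_i t ord0 i = 1.

(** Convexity, stated for combinations of any number of points so that it applies at once to all
    points of an affine simplex. *)
Definition hull_closed d (C : set 'rV[R]_d) := forall n (w : 'M[R]_(n, d)) t,
  barycoord t -> (forall i, C (row i w)) -> C (t *m w).

Definition rows_in d n (C : set 'rV[R]_d) (w : 'M[R]_(n, d)) :=
  forall i, C (row i w).

Definition hull d n (w : 'M[R]_(n, d)) : set 'rV[R]_d :=
  [set v | exists2 t, barycoord t & v = t *m w].

Lemma barycoord_mul n m (t : 'rV[R]_n) (s : 'M[R]_(n, m)) :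
  barycoord t -> (forall i, barycoord (row i s)) -> barycoord (t *m s).
Proof.
move=> [t0 t1] sb; split=> [j|].
  rewrite mxE sumr_ge0// => i _; apply: mulr_ge0 => //.
  by have [/(_ j)] := sb i; rewrite mxE.
under eq_bigr do rewrite mxE.
rewrite exchange_big/= -[RHS]t1; apply: eq_bigr => i _.
rewrite -mulr_sumr; have [_] := sb i.
by under eq_bigr do rewrite mxE; move=> ->; rewrite mulr1.
Qed.

Lemma hull_closed_hull d n (w : 'M[R]_(n, d)) : hull_closed (hull w).
Proof.
move=> m v t tb /= /(_ _)/cid2-/all_sig[s].
move=> /all_and2[sb vs].
exists (t *m \matrix_i s i); last first.
  rewrite -mulmxA; congr (_ *m _); apply/row_matrixP => i.
  by rewrite row_mul rowK.
by apply: barycoord_mul => // i; rewrite rowK.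
Qed.

Lemma barycoord_delta n (i : 'I_n) : barycoord (delta_mx ord0 i).
Proof.
split=> [j|]; first by rewrite mxE; case: (_ && _).
rewrite (bigD1 i)//= big1 ?addr0 => [|j ji]; first by rewrite mxE !eqxx.
by rewrite mxE (negbTE ji) andbF.
Qed.

Lemma hull_row d n (w : 'M[R]_(n, d)) i : hull w (row i w).
Proof.
by exists (delta_mx ord0 i); [exact: barycoord_delta|rewrite -rowE].
Qed.

Lemma sub_hull d n (w : 'M[R]_(n, d)) (C : set 'rV[R]_d) :
  hull_closed C -> rows_in C w -> hull w `<=` C.
Proof. by move=> hC wC _ [t tb ->]; exact: hC. Qed.

Lemma barycoord_const n : barycoord (const_mx n.+1%:R^-1 : 'rV[R]_n.+1).
Proof.
split=> [i|]; first by rewrite mxE invr_ge0.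
under eq_bigr do rewrite mxE.
by rewrite sumr_const card_ord -[_ *+ _]mulr_natl divff// pnatr_eq0.
Qed.

Lemma hull_bary d n (w : 'M[R]_(n.+1, d)) : hull w (bary w).
Proof. by exists (const_mx n.+1%:R^-1) => //; exact: barycoord_const. Qed.

Lemma row_col_mx0 d n (b : 'rV[R]_d) (w : 'M[R]_(n, d)) :
  row ord0 (col_mx b w : 'M[R]_(n.+1, d)) = b.
Proof. by apply/rowP => j; rewrite [LHS]mxE col_mx0E. Qed.

Lemma row_col_mx_lift d n (b : 'rV[R]_d) (w : 'M[R]_(n, d)) i :
  row (lift ord0 i) (col_mx b w : 'M[R]_(n.+1, d)) = row i w.
Proof. by apply/rowP => j; rewrite [LHS]mxE col_mx_liftE mxE. Qed.

Definition mesh_le d n (e : R) (w : 'M[R]_(n, d)) :=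
  forall i j k, `|w i k - w j k| <= e.

Definition fine_in d n (C : set 'rV[R]_d) e (w : 'M[R]_(n, d)) :=
  rows_in C w /\ mesh_le e w.

Lemma supp_aff_bd d n (P : 'M[R]_(n.+1, d) -> Prop) (Q : 'M[R]_(n, d) -> Prop)
    (x : aff R d n.+1) :
  (forall w i, P w -> Q (row' i w)) -> supp P x -> supp Q (aff_bd x).
Proof.
move=> PQ; apply: supp_flift => w Pw; apply: supp_sum => i _.
by apply: suppMz; apply: supp_gen; exact: PQ.
Qed.

Lemma rows_in_row' d n (C : set 'rV[R]_d) (w : 'M[R]_(n.+1, d)) i :
  rows_in C w -> rows_in C (row' i w).
Proof.
move=> wC j; rewrite (_ : row j _ = row (lift i j) w)//.
by apply/rowP => k; rewrite !mxE.
Qed.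

Lemma rows_in_cone d n (C : set 'rV[R]_d) (b : 'rV[R]_d) (w : 'M[R]_(n, d)) :
  C b -> rows_in C w -> rows_in C (col_mx b w : 'M[R]_(n.+1, d)).
Proof.
move=> Cb Cw i; case: (unliftP ord0 i) => [k ->|->].
  by rewrite row_col_mx_lift.
by rewrite row_col_mx0.
Qed.

Lemma supp_cone d n (P : 'M[R]_(n, d) -> Prop) (Q : 'M[R]_(n.+1, d) -> Prop)
    (b : 'rV[R]_d) (x : aff R d n) :
  (forall w : 'M[R]_(n, d), P w -> Q (col_mx b w : 'M[R]_(n.+1, d))) ->
  supp P x -> supp Q (cone b x).
Proof. by move=> PQ; apply: supp_flift => w Pw; apply: supp_gen; exact: PQ. Qed.

(** The barycenter minus vertex [i] is the average of [n.+1] differences, of which the [i]-th is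
    zero; this produces the factor. *)
Lemma bary_dist d n (w : 'M[R]_(n.+1, d)) e i k : mesh_le e w ->
  `|bary w ord0 k - w i k| <= n%:R / n.+1%:R * e.
Proof.
move=> we; have n0 : (n.+1%:R : R) != 0 by rewrite pnatr_eq0.
have -> : bary w ord0 k - w i k =
    n.+1%:R^-1 * \sum_(j < n.+1 | j != i) (w j k - w i k).
  rewrite /bary mxE; under eq_bigr do rewrite mxE.
  rewrite -mulr_sumr -[X in _ - X](mulKf n0) -mulrBr; congr (_ * _).
  rewrite (bigD1 i)//= sumrB sumr_const cardC1 card_ord.
  by rewrite mulr_natl mulrS; ring.
rewrite normrM ger0_norm ?invr_ge0// [leRHS]mulrAC [leRHS]mulrC.
apply: ler_wpM2l; first by rewrite invr_ge0.
apply: le_trans (ler_norm_sum _ _ _) _.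
apply: (@le_trans _ _ (\sum_(j < n.+1 | j != i) e)).
  by apply: ler_sum => j _; exact: we.
by rewrite sumr_const cardC1 card_ord/= mulr_natl.
Qed.

Lemma hull_bary_dist d n (w : 'M[R]_(n.+1, d)) e v k : mesh_le e w ->
  hull w v -> `|bary w ord0 k - v ord0 k| <= n%:R / n.+1%:R * e.
Proof.
move=> we [t [t0 t1] ->]; rewrite [X in _ - X]mxE.
have tE (y : R) : y = \sum_i t ord0 i * y by rewrite -mulr_suml t1 mul1r.
rewrite [bary w ord0 k]tE [leRHS]tE -sumrB.
apply: le_trans (ler_norm_sum _ _ _) _; apply: ler_sum => i _.
by rewrite -mulrBr normrM ger0_norm//; apply: ler_wpM2l => //; exact: bary_dist.
Qed.

(** The contraction factor grows with the dimension. Since [M] bounds the dimension of every simplex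
    met in the induction, a single factor serves for all of them. *)
Lemma sd_fine d M n (C : set 'rV[R]_d) e (x : aff R d n) : (n <= M.+1)%N ->
  0 <= e -> hull_closed C ->
  supp (fine_in C e) x -> supp (fine_in C (M%:R / M.+1%:R * e)) (sd x).
Proof.
move=> + e0; elim: n C x => [|n IH] C x nM hC.
  rewrite sd0; apply: sub_supp => w [Cw _]; split=> //.
  by case.
apply: supp_flift => w [Cw we].
change (supp (fine_in C (M%:R / M.+1%:R * e))
  (cone (bary w) (sd (aff_bd (gen w))))).
have [xb xe] : hull w (bary w) /\ mesh_le e w by split=> //; exact: hull_bary.
(* The induction hypothesis is used inside [hull w] rather than [C], so that the new vertices can be
   compared with the barycenter of [w]. *)
have : supp (fine_in (hull w) (M%:R / M.+1%:R * e)) (sd (aff_bd (gen w))).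
  apply: IH; [exact: ltnW|exact: hull_closed_hull|].
  apply: (@supp_aff_bd _ _ (fine_in (hull w) e)); last first.
    by apply: supp_gen; split=> // i; exact: hull_row.
  move=> v i [vC ve]; split; first exact: rows_in_row'.
  by move=> j k l; rewrite !mxE.
have nMe : n%:R / n.+1%:R * e <= M%:R / M.+1%:R * e.
  apply: ler_wpM2r => //; rewrite ler_pdivrMr ?ltr0n// mulrAC.
  by rewrite ler_pdivlMr ?ltr0n// -!natrM ler_nat !mulnS [(n * M)%N]mulnC leq_add2r.
apply: supp_cone => v [hv ve]; split.
  apply: rows_in_cone; first exact: sub_hull xb.
  by move=> i; apply: sub_hull (hv i).
move=> i j k; case: (unliftP ord0 i) => [i' ->|->];
  case: (unliftP ord0 j) => [j' ->|->]; rewrite ?col_mx_liftE ?col_mx0E//.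
- rewrite distrC; apply: le_trans nMe.
  have := hull_bary_dist k we (hv i'); by rewrite [row _ _ _ _]mxE.
- apply: le_trans nMe.
  have := hull_bary_dist k we (hv j'); by rewrite [row _ _ _ _]mxE.
- by rewrite subrr normr0 mulr_ge0// divr_ge0.
Qed.

Lemma sdn_fine d M N n (C : set 'rV[R]_d) e (x : aff R d n) : (n <= M.+1)%N ->
  0 <= e -> hull_closed C -> supp (fine_in C e) x ->
  supp (fine_in C ((M%:R / M.+1%:R) ^+ N * e)) (sdn N x).
Proof.
move=> nM e0 hC xC; elim: N => [|N IH]; first by rewrite expr0 mul1r.
rewrite exprS -mulrA; apply: sd_fine => //.
by rewrite mulr_ge0// exprn_ge0// divr_ge0.
Qed.

Lemma supp_sd d n (C : set 'rV[R]_d) (x : aff R d n) :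
  hull_closed C -> supp (rows_in C) x -> supp (rows_in C) (sd x).
Proof.
move=> hC; elim: n x => [|n IH] x; first by rewrite sd0.
apply: supp_flift => w wC.
change (supp (rows_in C) (cone (bary w) (sd (aff_bd (gen w))))).
apply: (@supp_cone _ _ (rows_in C)) => [v|].
  by apply: rows_in_cone; apply: sub_hull (hull_bary _).
apply: IH; apply: (@supp_aff_bd _ _ (rows_in C)); last exact: supp_gen.
by move=> v i; exact: rows_in_row'.
Qed.

Lemma supp_sdn d N n (C : set 'rV[R]_d) (x : aff R d n) :
  hull_closed C -> supp (rows_in C) x -> supp (rows_in C) (sdn N x).
Proof. by move=> hC xC; elim: N => //= N; exact: supp_sd. Qed.

Lemma supp_cyl d N n (C : set 'rV[R]_d) (C' : set 'rV[R]_(d + 1))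
    (x : aff R d n) : hull_closed C' ->
  (forall v : 'rV[R]_d, C v -> C' (topmx v) /\ C' (botmx v)) ->
  supp (rows_in C) x -> supp (rows_in C') (cyl N x).
Proof.
move=> hC' CC'.
have topC m (w : 'M[R]_(m, d)) : rows_in C w -> rows_in C' (topmx w).
  move=> wC i; rewrite row_row_mx row_const; exact: (CC' _ (wC i)).1.
have botC m (w : 'M[R]_(m, d)) : rows_in C w -> rows_in C' (botmx w).
  move=> wC i; rewrite row_row_mx row0; exact: (CC' _ (wC i)).2.
elim: n x => [|n IH] x; first by rewrite cyl0 => _; exact: supp0.
apply: supp_flift => w wC.
change (supp (rows_in C') (cone (bary (topmx w)) (top (gen w) -
  sdn N (bot (gen w)) - cyl N (aff_bd (gen w))))).
apply: (@supp_cone _ _ (rows_in C')) => [v|].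
  apply: rows_in_cone; apply: sub_hull (hull_bary _) => //; exact: topC.
apply: suppB; first apply: suppB.
- by rewrite /top flift_gen; apply: supp_gen; exact: topC.
- by apply: supp_sdn => //; rewrite /bot flift_gen; apply: supp_gen; exact: botC.
- apply: IH; apply: (@supp_aff_bd _ _ (rows_in C)); last exact: supp_gen.
  by move=> v i; exact: rows_in_row'.
Qed.

End Subdivision.

(** Cancellation only removes generators. Passing to the reduced form allows two different
    presentations of one chain to be compared, which is how [suppI] intersects supports. *)
Lemma supp_dom (K : choiceType) (P : K -> Prop) (x : {freeg K}) :
  supp P x <-> forall k, k \in dom x -> P k.
Proof.
split=> [|xP].
  elim=> {x} [|k Pk|x y _ IHx _ IHy|x _ IHx] l.
  - by rewrite dom0.
  - by rewrite domU1 inE => /eqP ->.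
  - by move/domD_subset; rewrite mem_cat => /orP[/IHx|/IHy].
  - by rewrite domN => /IHx.
rewrite -[x]freeg_sumE big_seq; apply: supp_sum => k /xP Pk.
by rewrite -[coeff k x]intz -freegU_mulz; apply: suppMz; exact: supp_gen.
Qed.

Lemma suppI (K : choiceType) (P Q : K -> Prop) (x : {freeg K}) :
  supp P x -> supp Q x -> supp (fun k => P k /\ Q k) x.
Proof.
by move=> /supp_dom xP /supp_dom xQ; apply/supp_dom => k kx; split; auto.
Qed.

(** * Faces of the standard simplex *)

Section Faces.
Variable R : realType.

Lemma face_map_diag k (i : 'I_k.+2) (t : 'rV[R]_k.+1) :
  face_map i t ord0 i = 0.
Proof. by rewrite mxE ltnn eqxx. Qed.

Lemma face_map_lift k (i : 'I_k.+2) (t : 'rV[R]_k.+1) j :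
  face_map i t ord0 (lift i j) = t ord0 j.
Proof.
rewrite mxE /= /bump; case: (leqP i j) => ij; rewrite ?add1n ?add0n.
  rewrite ltnNge (leqW ij)/= gtn_eqF ?ltnS//.
  by congr (t _ _); apply: val_inj; rewrite /= inordK.
by rewrite ij; congr (t _ _); apply: val_inj; rewrite /= inordK.
Qed.

(** Restricting an affine simplex to a face deletes a row of its vertex matrix; this matches the
    affine boundary with the singular one. *)
Lemma face_map_mul k d (i : 'I_k.+2) (t : 'rV[R]_k.+1) (w : 'M[R]_(k.+2, d)) :
  face_map i t *m w = t *m row' i w.
Proof.
apply/rowP => j; rewrite !mxE (bigD1_ord i)//= face_map_diag mul0r add0r.
by apply: eq_bigr => l _; rewrite face_map_lift mxE.
Qed.

Lemma face_mapE k (i : 'I_k.+2) (t : 'rV[R]_k.+1) :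
  face_map i t = t *m row' i 1%:M.
Proof. by rewrite -face_map_mul mulmx1. Qed.

Lemma stdsimplex_face k (i : 'I_k.+2) (t : 'rV[R]_k.+1) :
  @stdsimplex R k.+1 (face_map i t) <-> @stdsimplex R k t.
Proof.
split=> -[t0 t1]; split.
- by move=> j; rewrite -(face_map_lift i).
- move: t1; rewrite (bigD1_ord i)//= face_map_diag add0r => <-.
  by apply: eq_bigr => j _; rewrite face_map_lift.
- move=> j; case: (unliftP i j) => [l ->|->]; rewrite ?face_map_lift//.
  by rewrite face_map_diag.
- rewrite (bigD1_ord i)//= face_map_diag add0r -[RHS]t1.
  by apply: eq_bigr => j _; rewrite face_map_lift.
Qed.

End Faces.

Lemma cvg_rV (R : realType) (T : Type) (F : set_system T) d
    (f : T -> 'rV[R]_d) (l : 'rV[R]_d) : Filter F ->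
  (forall j, f x ord0 j @[x --> F] --> l ord0 j) -> f x @[x --> F] --> l.
Proof.
move=> FF fl A [P Pl PA]; rewrite nbhs_simpl/=.
suff : \forall x \near F, forall j, P ord0 j (f x ord0 j).
  by apply: filterS => x Px; apply: PA => i j; rewrite ord1.
by apply: filter_forall => j; apply: fl; exact: Pl.
Qed.

Lemma cvg_sumr (R : realType) (T : Type) (F : set_system T) d
    (f : 'I_d -> T -> R) (l : 'I_d -> R) : Filter F ->
  (forall j, f j x @[x --> F] --> l j) ->
  \sum_j f j x @[x --> F] --> \sum_j l j.
Proof.
move=> FF fl; elim: (index_enum _) => [|j s IH].
  under eq_fun do rewrite big_nil; rewrite big_nil; exact: cvg_cst.
under eq_fun do rewrite big_cons; rewrite big_cons; exact: cvgD.
Qed.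

Lemma continuous_mulmx (R : realType) d d' (w : 'M[R]_(d, d')) :
  continuous (fun t : 'rV[R]_d => t *m w).
Proof.
move=> t; apply: (@cvg_rV _ _ (nbhs t)) => j; rewrite mxE; under eq_fun do rewrite mxE.
apply: (@cvg_sumr _ _ (nbhs t)) => i.
apply: cvgMl; exact: coord_continuous.
Qed.

Section WithinComp.
Context {T U V : topologicalType}.

Lemma within_comp (A : set T) (B : set U) (f : T -> U) (g : U -> V) :
  {within A, continuous f} -> (forall x, A x -> B (f x)) ->
  {within B, continuous g} -> {within A, continuous (g \o f)}.
Proof.
move=> /subspace_continuousP cf AB /subspace_continuousP cg.
apply/subspace_continuousP => x Ax; apply: cvg_comp (cg _ (AB _ Ax)).
move=> S /= BS; have := cf x Ax _ BS; rewrite !nbhs_simpl/= => AS.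
rewrite /within/= in AS *; near=> y => Ay.
have : A y -> B (f y) -> S (f y) by near: y.
by apply => //; exact: AB.
Unshelve. all: by end_near. Qed.

Lemma within_pair (A : set T) (f : T -> U) (g : T -> V) :
  {within A, continuous f} -> {within A, continuous g} ->
  {within A, continuous (fun x => (f x, g x))}.
Proof.
move=> /subspace_continuousP cf /subspace_continuousP cg.
apply/subspace_continuousP => x Ax.
have := cvg_pair (cf x Ax) (cg x Ax); exact.
Qed.

End WithinComp.

(** * Singular chains as elements of a free abelian group *)

Section SingularChains.
Variables (R : realType) (Y : topologicalType) (y0 : Y).

Definition smp k := 'rV[R]_k.+1 -> Y.

(* Representative of the functions that agree with [s] on the standard simplex,
   so that equality of singular simplices becomes equality of functions. *)
Definition canon k (s : smp k) : smp k :=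
  fun t => if `[< @stdsimplex R k t >] then s t else y0.

Definition sg k (s : smp k) : {freeg smp k} := gen (canon s).

Lemma canonE k (s s' : smp k) :
  canon s = canon s' <-> (forall t, @stdsimplex R k t -> s t = s' t).
Proof.
split=> [ss' t tS|ss'].
  by have := congr1 (fun f => f t) ss'; rewrite /canon; case: asboolP.
by apply: funext => t; rewrite /canon; case: asboolP => // /ss'.
Qed.

Lemma canonK k (s : smp k) : canon (canon s) = canon s.
Proof. by apply/canonE => t tS; rewrite /canon; case: asboolP. Qed.

Lemma eq_sg k (s s' : smp k) :
  (forall t, @stdsimplex R k t -> s t = s' t) -> sg s = sg s'.
Proof. by move=> ss'; congr gen; exact/canonE. Qed.

Lemma canon_face k (s : smp k.+1) i :
  canon (s \o face_map i) = canon s \o face_map i.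
Proof.
apply: funext => t; rewrite /canon/=.
by case: asboolP; case: asboolP => // /stdsimplex_face.
Qed.

Definition sing_bd k : {freeg smp k.+1} -> {freeg smp k} :=
  flift (fun s : smp k.+1 => \sum_(i < k.+2) gen (s \o face_map i : smp k) *~ ((-1) ^+ i)).

HB.instance Definition _ k := GRing.Additive.on (@sing_bd k).

Lemma sing_bd_sg k (s : smp k.+1) :
  sing_bd (sg s) = \sum_(i < k.+2) sg (s \o face_map i) *~ ((-1) ^+ i).
Proof.
rewrite /sing_bd flift_gen; apply: eq_bigr => i _.
by rewrite /sg canon_face.
Qed.

Definition spush k d (h : 'rV[R]_d -> Y) : aff R d k.+1 -> {freeg smp k} :=
  flift (fun w => sg (fun t => h (t *m w))).

HB.instance Definition _ k d h := GRing.Additive.on (@spush k d h).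

Lemma spush_gen k d (h : 'rV[R]_d -> Y) (w : 'M[R]_(k.+1, d)) :
  spush h (gen w) = sg (fun t => h (t *m w)).
Proof. exact: flift_gen. Qed.

Lemma spush_bd k d (h : 'rV[R]_d -> Y) (x : aff R d k.+2) :
  sing_bd (spush h x) = spush h (aff_bd x).
Proof.
elim/free_ind: x => [|w|x y Hx Hy|x Hx];
  rewrite ?raddf0// ?raddfD ?raddfN/= ?Hx ?Hy//.
rewrite spush_gen sing_bd_sg /aff_bd flift_gen raddf_sum/=.
apply: eq_bigr => i _; rewrite raddfMz/= spush_gen; congr (_ *~ _).
by apply: eq_sg => t _ /=; rewrite face_map_mul.
Qed.

Lemma spush_push k d d' (h : 'rV[R]_d' -> Y) (a : 'M[R]_(d, d'))
    (x : aff R d k.+1) :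
  spush (fun v => h (v *m a)) x = spush h (push a x).
Proof.
elim/free_ind: x => [|w|x y Hx Hy|x Hx];
  rewrite ?raddf0// ?raddfD ?raddfN/= ?Hx ?Hy//.
rewrite /push flift_gen !spush_gen; apply: eq_sg => t _.
by rewrite mulmxA.
Qed.

Definition simp (A : set Y) k (s : smp k) := canon s = s /\ sing_in A s.
Arguments simp A {k} s.

Lemma sing_in_eq (A : set Y) k (s s' : smp k) :
  (forall t, @stdsimplex R k t -> s t = s' t) -> sing_in A s -> sing_in A s'.
Proof.
move=> ss' [cs sA]; split; last first.
  by move=> _ [t tS <-]; rewrite -ss'//; apply: sA; exists t.
apply: subspace_eq_continuous cs => t; rewrite inE; exact: ss'.
Qed.

Lemma simp_canon (A : set Y) k (s : smp k) : sing_in A s -> simp A (canon s).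
Proof.
move=> sA; split; first exact: canonK.
by apply: sing_in_eq sA => t tS; rewrite /canon; case: asboolP.
Qed.

Lemma supp_sg (A : set Y) k (s : smp k) : sing_in A s -> supp (simp A) (sg s).
Proof. by move=> sA; apply: supp_gen; exact: simp_canon. Qed.

Lemma simp_sub (A B : set Y) k (s : smp k) : A `<=` B -> simp A s -> simp B s.
Proof. by move=> AB [cs [ss sA]]; split=> //; split=> //; exact: subset_trans AB. Qed.

Lemma supp_spush (A : set Y) k d (D : set 'rV[R]_d)
   (h : 'rV[R]_d -> Y) (x : aff R d k.+1) : hull_closed D ->
  {within D, continuous h} -> (forall v, D v -> A (h v)) ->
  supp (rows_in D) x -> supp (simp A) (spush h x).
Proof.
move=> hD hc DA; apply: supp_flift => w wD; apply: supp_sg; split.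
  apply: (within_comp _ _ hc).
    by apply: continuous_subspaceT; exact: continuous_mulmx.
  by move=> t tS; exact: hD.
by move=> _ [t tS <-]; apply: DA; exact: hD.
Qed.

Lemma eq_spush k d (D : set 'rV[R]_d) (h h' : 'rV[R]_d -> Y)
    (x : aff R d k.+1) : hull_closed D -> (forall v, D v -> h v = h' v) ->
  supp (rows_in D) x -> spush h x = spush h' x.
Proof.
move=> hD hh'; apply: eq_flift_supp => w wD; apply: eq_sg => t tS.
by apply: hh'; exact: hD.
Qed.

Lemma sing_in_face (A : set Y) m (s : smp m.+1) i :
  sing_in A s -> sing_in A (s \o face_map i : smp m).
Proof.
move=> [cs sA]; split.
  apply: (within_comp _ _ cs) => [|t]; last by move/stdsimplex_face; exact.
  apply: continuous_subspaceT => t.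
  rewrite (_ : face_map i = fun t => t *m row' i 1%:M).
    exact: continuous_mulmx.
  by apply: funext => u; rewrite face_mapE.
by move=> _ [t tS <-]; apply: sA; exists (face_map i t) => //; exact/stdsimplex_face.
Qed.

Lemma sing_in_sub (A B : set Y) m (s : smp m) :
  A `<=` B -> sing_in A s -> sing_in B s.
Proof. by move=> AB [cs sA]; split=> //; exact: subset_trans AB. Qed.

Lemma supp_sing_bd (A : set Y) k (x : {freeg smp k.+1}) :
  supp (simp A) x -> supp (simp A) (sing_bd x).
Proof.
apply: supp_flift => s [sc sA]; apply: supp_sum => i _; apply: suppMz.
by apply: supp_gen; split; [rewrite canon_face sc|exact: sing_in_face].
Qed.

Definition of_chain k (c : chain R Y k) : {freeg smp k} :=
  \sum_(p <- c) sg p.2 *~ p.1.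

Lemma coeff_of_chain k (c : chain R Y k) (s : smp k) :
  coeff (canon s) (of_chain c) = coef c s.
Proof.
rewrite /coef big_mkcond/= /of_chain raddf_sum/=; apply: eq_bigr => p _.
rewrite raddfMz/= /sg /gen coeffU mul1r.
have -> : (canon p.2 == canon s) = `[< forall t, @stdsimplex R k t -> p.2 t = s t >].
  by apply/eqP/asboolP => /canonE.
by case: asboolP => _; rewrite ?mul0rz// mulr1n intz.
Qed.

(** The coefficients of [of_chain] vanish at functions that are not canonical, and at canonical ones
    they are those given by [coef]. *)
Lemma chain_eqvP k (c d : chain R Y k) :
  chain_eqv c d <-> of_chain c = of_chain d.
Proof.
split=> [cd|cd s]; last by rewrite -!coeff_of_chain cd.
apply/eqP/freeg_eqP => s; have [sc|sc] := eqVneq (canon s) s.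
  by rewrite -sc !coeff_of_chain.
suff H (e : chain R Y k) : coeff s (of_chain e) = 0 by rewrite !H.
rewrite /of_chain raddf_sum/= big1// => p _.
have /negbTE ps : canon p.2 != s by apply: contraNneq sc => <-; rewrite canonK.
by rewrite raddfMz/= /sg /gen coeffU mul1r ps mul0rz.
Qed.

Lemma of_chain_cat k (c d : chain R Y k) :
  of_chain (c ++ d) = of_chain c + of_chain d.
Proof. exact: big_cat. Qed.

Lemma of_chain_boundary k (c : chain R Y k.+1) :
  of_chain (boundary c) = sing_bd (of_chain c).
Proof.
elim: c => [|[a s] c IH]; first by rewrite /of_chain !big_nil raddf0.
rewrite /boundary/= of_chain_cat -/(boundary c) IH.
rewrite [in RHS]/of_chain big_cons raddfD/= -/(of_chain c); congr (_ + _).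
rewrite raddfMz/= sing_bd_sg /of_chain big_map mulrz_suml big_enum/=.
by apply: eq_bigr => i _; rewrite mulrC mulrzA mulrzAC.
Qed.

Lemma supp_of_chain (A : set Y) k (c : chain R Y k) :
  chain_in A c -> supp (simp A) (of_chain c).
Proof.
elim: c => [|[a s] c IH]; first by rewrite /of_chain big_nil => _; exact: supp0.
move=> /andP[/asboolP/= sA cA]; rewrite /of_chain big_cons.
by apply: suppD; [apply: suppMz; exact: supp_sg|exact: IH].
Qed.

Lemma chain_of_supp (A : set Y) k (x : {freeg smp k}) :
  supp (simp A) x -> exists2 c : chain R Y k, chain_in A c & of_chain c = x.
Proof.
elim=> {x} [|s [sc sA]|x y _ [c cA <-] _ [d dA <-]|x _ [c cA <-]].
- by exists [::] => //; rewrite /of_chain big_nil.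
- exists [:: (1, s)]; first by rewrite /chain_in/= andbT; exact/asboolP.
  by rewrite /of_chain big_seq1/= /sg sc mulr1z.
- exists (c ++ d); rewrite ?of_chain_cat// /chain_in all_cat.
  by apply/andP; split.
- exists [seq (- p.1, p.2) | p <- c].
    by rewrite /chain_in all_map; apply: sub_all cA.
  rewrite /of_chain big_map -sumrN; apply: eq_bigr => p _.
  by rewrite mulrNz.
Qed.

End SingularChains.

Arguments simp {R Y} y0 A {k} s.

(** * Compactness of the simplex and Lebesgue numbers *)

Section Simplex.
Variable R : realType.

Lemma hull_closed_stdsimplex k : hull_closed (@stdsimplex R k).
Proof. by move=> n w t; exact: barycoord_mul. Qed.

Lemma rows_in_1 k : rows_in (@stdsimplex R k) 1%:M.
Proof. by move=> i; rewrite row1; exact: barycoord_delta. Qed.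

Lemma stdsimplex_le1 k (t : 'rV[R]_k.+1) i : @stdsimplex R k t -> t ord0 i <= 1.
Proof.
by move=> [t0 <-]; rewrite (bigD1 i)//= lerDl sumr_ge0.
Qed.

Lemma closed_stdsimplex k : closed (@stdsimplex R k).
Proof.
have -> : @stdsimplex R k = (\bigcap_i [set t | 0 <= t ord0 i]) `&`
    [set t | \sum_i t ord0 i = 1].
  apply/seteqP; split=> t [t0 t1]; split=> // i; first by move=> _; exact: t0.
  exact: (t0 i).
apply: closedI.
  apply: closed_bigI => i _.
  apply: (@closed_comp _ _ (fun t : 'rV[R]_k.+1 => t ord0 i) [set x | 0 <= x]).
    by move=> ? _; exact: coord_continuous.
  exact: closed_ge.
apply: (@closed_comp _ _ (fun t : 'rV[R]_k.+1 => \sum_i t ord0 i) [set x | x = 1]).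
  move=> t _; apply: (@cvg_sumr _ _ (nbhs t)) => i; exact: coord_continuous.
exact: closed_eq.
Qed.

Lemma compact_stdsimplex k : compact (@stdsimplex R k).
Proof.
have cB : compact [set v : 'rV[R]_k.+1 | forall i, `[0, 1]%classic (v ord0 i)].
  by apply: (@rV_compact R k.+1 (fun=> `[0, 1]%classic)) => i; exact: segment_compact.
apply: subclosed_compact cB _; first exact: closed_stdsimplex.
by move=> t tS i; rewrite /= in_itv/= stdsimplex_le1// andbT; case: tS.
Qed.

Lemma lebesgue_number k (Y : topologicalType) (I : Type) (O : I -> set Y)
    (f : 'rV[R]_k.+1 -> Y) : {within @stdsimplex R k, continuous f} ->
  (forall i, open (O i)) ->
  (forall t, @stdsimplex R k t -> exists i, O i (f t)) ->
  exists2 e : R, 0 < e & forall t, @stdsimplex R k t -> exists i,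
    forall t', @stdsimplex R k t' ->
      (forall j, `|t ord0 j - t' ord0 j| <= e) -> O i (f t').
Proof.
move=> /subspace_continuousP cf oO fO.
have /compact_near_coveringP cS := @compact_stdsimplex k.
pose P (e : R) t := @stdsimplex R k t -> exists i,
  forall t', @stdsimplex R k t' ->
    (forall j, `|t ord0 j - t' ord0 j| <= e) -> O i (f t').
suff loc t : @stdsimplex R k t ->
    \forall t' \near t & e \near (0 : R)^'+, P e t'.
  have SP : \forall e \near (0 : R)^'+, @stdsimplex R k `<=` P e by exact: cS.
  have [e [/= e0 eP]] := filter_ex (filterI (nbhs_right_gt (0 : R)) SP).
  by exists e => // t tS; exact: eP.
move=> tS; have [i Oi] := fO _ tS.
  have /nbhs_ballP[d /= d0 dO] := cf _ tS _ (open_nbhs_nbhs (conj (oO i) Oi)).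
  exists (ball t (d / 2), [set e | 0 < e < d / 2]) => /=.
    split; first by apply: nbhsx_ballx; rewrite divr_gt0.
    near=> e; apply/andP; split; near: e; first exact: nbhs_right_gt.
    by apply: nbhs_right_lt; rewrite divr_gt0.
  move=> [t' e]/= [[_ tt'] /andP[e0 ed]] t'S; exists i => t'' t''S t't''.
  apply: (dO t'') => //; split=> // a j.
  rewrite (splitr d); apply: (@ball_triangle _ _ (t' a j)); first exact: tt'.
  rewrite -ball_normE/= ord1; apply: le_lt_trans ed; exact: t't''.
Unshelve. all: by end_near. Qed.

End Simplex.

(** The universal simplex: operators on singular chains are defined by pushing forward their value
    on it, and naturality of the affine operators then gives the boundary formulas. *)
Definition idaff (R : realType) n : aff R n n := gen (1%:M : 'M[R]_n).

(** * Subdivision of singular chains *)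

Section SubdivisionOperator.
Variables (R : realType) (Y : topologicalType) (y0 : Y).
Local Notation smp := (smp R Y).

Definition SdF N k : {freeg smp k} -> {freeg smp k} :=
  flift (fun s : smp k => spush y0 s (sdn N (idaff R k.+1))).

HB.instance Definition _ N k := GRing.Additive.on (@SdF N k).

Lemma supp_sdn1 N k :
  supp (rows_in (@stdsimplex R k)) (sdn N (idaff R k.+1)).
Proof.
apply: supp_sdn; first exact: hull_closed_stdsimplex.
by rewrite /idaff; apply: supp_gen; exact: rows_in_1.
Qed.

Lemma SdF_sg N k (s : smp k) :
  SdF N (sg y0 s) = spush y0 s (sdn N (idaff R k.+1)).
Proof.
rewrite /SdF flift_gen.
apply: (eq_spush y0 (@hull_closed_stdsimplex R k)) (supp_sdn1 N k).
by move=> v vS; rewrite /canon; case: asboolP.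
Qed.

Lemma supp_SdF (A : set Y) N k (x : {freeg smp k}) :
  supp (simp y0 A) x -> supp (simp y0 A) (SdF N x).
Proof.
apply: supp_flift => s [_ [cs sA]].
apply: (supp_spush y0 (@hull_closed_stdsimplex R k)) (supp_sdn1 N k) => //.
by move=> v vS; apply: sA; exists v.
Qed.

Lemma gen_row'1 k (i : 'I_k.+2) :
  gen (row' i 1%:M) = push (row' i (1%:M : 'M[R]_k.+2)) (idaff R k.+1).
Proof. by rewrite /idaff /push flift_gen mul1mx. Qed.

Lemma smp_face k (s : smp k.+1) i :
  (s \o face_map i) = fun v => s (v *m row' i (1%:M : 'M[R]_k.+2)).
Proof. by apply: funext => v; rewrite /= face_mapE. Qed.

Lemma SdF_bd N k (x : {freeg smp k.+1}) :
  sing_bd (SdF N x) = SdF N (sing_bd x).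
Proof.
elim/free_ind: x => [|s|x y Hx Hy|x Hx];
  rewrite ?raddf0// ?raddfD ?raddfN/= ?Hx ?Hy//.
rewrite {1}/SdF flift_gen spush_bd -sdn_bd /idaff /aff_bd flift_gen !raddf_sum/=.
rewrite /sing_bd flift_gen raddf_sum/=; apply: eq_bigr => i _.
rewrite !raddfMz/= gen_row'1 sdn_push -spush_push {1}/SdF flift_gen.
by rewrite smp_face.
Qed.

(** The mesh of the subdivided standard simplex tends to [0], so it falls below the Lebesgue number
    of each of the finitely many simplices of [x]. *)
Lemma SdF_small (I : Type) (O : I -> set Y) (B : set Y) k (x : {freeg smp k}) :
  (forall i, open (O i)) -> (forall y, B y -> exists i, O i y) ->
  supp (simp y0 B) x ->
  exists N0, forall N, (N0 <= N)%N ->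
    supp (fun s => exists i, simp y0 (O i `&` B) s) (SdF N x).
Proof.
move=> oO BO; elim=> {x} [|s [_ [cs sB]]|x y _ [Nx Hx] _ [Ny Hy]|x _ [Nx Hx]].
- by exists 0%N => N _; rewrite raddf0; exact: supp0.
- have sB' t : @stdsimplex R k t -> B (s t) by move=> tS; apply: sB; exists t.
  have [|e e0 He] := lebesgue_number cs oO; first by move=> t /sB' /BO.
  have : (fun N => (k%:R / k.+1%:R : R) ^+ N) @ \oo --> (0 : R).
    apply: cvg_expr; rewrite ger0_norm ?divr_ge0// ltr_pdivrMr ?ltr0n//.
    by rewrite mul1r ltr_nat.
  move=> /cvgrPdist_le/(_ _ e0)[N0 _ N0e]; exists N0 => N /N0e; rewrite /= sub0r normrN.
  rewrite ger0_norm ?exprn_ge0 ?divr_ge0// => Ne.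
  rewrite /SdF flift_gen.
  (* The initial mesh is [1]: coordinates of two vertices of the standard simplex differ by at most
     [1]. *)
  have : supp (fine_in (@stdsimplex R k) ((k%:R / k.+1%:R) ^+ N * 1))
      (sdn N (idaff R k.+1)).
    apply: sdn_fine => //; first exact: hull_closed_stdsimplex.
    rewrite /idaff; apply: supp_gen; split; first exact: rows_in_1.
    by move=> i j l; rewrite !mxE; do 2 case: (_ == _);
      rewrite ?subrr ?subr0 ?sub0r ?normrN ?normr0 ?normr1.
  apply: supp_flift => w [wS wN].
  (* All points of a small simplex are within its mesh of its first vertex, so the open set found at
     that vertex contains the image of the whole simplex. *)
  have [i Oi] := He _ (wS ord0); apply: supp_gen; exists i; apply: simp_canon.
  have tw t : @stdsimplex R k t -> @stdsimplex R k (t *m w).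
    by move=> tS; exact: hull_closed_stdsimplex.
  split.
    apply: (within_comp _ tw cs).
    by apply: continuous_subspaceT; exact: continuous_mulmx.
  move=> _ [t tS <-]; split; last exact: sB' (tw _ tS).
  apply: Oi (tw _ tS) _ => j; have [t0 t1] := tS.
  have tE (y : R) : y = \sum_i t ord0 i * y by rewrite -mulr_suml t1 mul1r.
  rewrite mxE [X in _ - X]mxE [w ord0 j]tE -sumrB.
  apply: le_trans (ler_norm_sum _ _ _) _; rewrite [e]tE; apply: ler_sum => l _.
  rewrite -mulrBr normrM ger0_norm//; apply: ler_wpM2l => //.
  by apply: le_trans Ne; rewrite -[leRHS]mulr1.
- exists (maxn Nx Ny) => N; rewrite geq_max => /andP[/Hx Px /Hy Py].
  by rewrite raddfD; exact: suppD.
- by exists Nx => N /Hx; rewrite raddfN; exact: suppN.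
Qed.

End SubdivisionOperator.

(** * Prism operators of natural families of maps on cylinders *)

Section Cylinder.
Variables (R : realType) (Y1 Y2 : topologicalType) (y2 : Y2).
Variable H : forall k, smp R Y1 k -> 'rV[R]_(k.+1 + 1) -> Y2.
Hypothesis Hnat : forall k (s : smp R Y1 k.+1) i v,
  H (s \o face_map i : smp R Y1 k) v = H s (v *m cylmx (row' i (1%:M : 'M[R]_k.+2))).

(** Prism operator with the bottom subdivided [N] times. It serves twice: with [susp_cyl] and
    [N = 0] for the product with an interval, and with [const_cyl] for a homotopy from a chain to
    its subdivision. *)
Definition Cyl N k : {freeg smp R Y1 k} -> {freeg smp R Y2 k.+1} :=
  flift (fun s : smp R Y1 k => spush y2 (H s) (cyl N (idaff R k.+1))).

HB.instance Definition _ N k := GRing.Additive.on (@Cyl N k).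

(** The lateral part of the prism. Singular chains are not augmented, so a 0-chain has none. *)
Definition CylB N k : {freeg smp R Y1 k} -> {freeg smp R Y2 k} :=
  match k with
  | 0 => fun=> 0
  | k'.+1 => fun x => Cyl N (sing_bd x)
  end.

Lemma CylB_additive N k : {morph @CylB N k : x y / x - y}.
Proof. by case: k => [|k] x y /=; rewrite ?subrr// !raddfB. Qed.

HB.instance Definition _ N k :=
  GRing.isZmodMorphism.Build _ _ (@CylB N k) (@CylB_additive N k).

Definition topF k : {freeg smp R Y1 k} -> {freeg smp R Y2 k} :=
  flift (fun s : smp R Y1 k => sg y2 (fun t => H s (topmx t))).
HB.instance Definition _ k := GRing.Additive.on (@topF k).

Definition botF k : {freeg smp R Y1 k} -> {freeg smp R Y2 k} :=
  flift (fun s : smp R Y1 k => sg y2 (fun t => H s (botmx t))).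
HB.instance Definition _ k := GRing.Additive.on (@botF k).

Lemma bd_Cyl N k (x : {freeg smp R Y1 k}) :
  sing_bd (Cyl N x) = topF x - SdF y2 N (botF x) - CylB N x.
Proof.
have E (s : smp R Y1 k) : sing_bd (Cyl N (gen s)) =
    topF (gen s) - SdF y2 N (botF (gen s)) - CylB N (gen s).
  rewrite {1}/Cyl flift_gen spush_bd bd_cyl !raddfB/=; congr (_ - _ - _).
  - rewrite /topF /top /idaff !flift_gen spush_gen; apply: eq_sg => t [_ t1].
    congr (H _ _); rewrite /topmx mul_mx_row mulmx1; congr row_mx.
    by apply/rowP => j; rewrite !mxE -[RHS]t1; apply: eq_bigr => i _; rewrite mxE mulr1.
  - have botE : bot (idaff R k.+1) = push (row_mx 1%:M 0) (idaff R k.+1).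
      by rewrite /idaff /bot /push !flift_gen mul1mx.
    rewrite /botF flift_gen SdF_sg botE.
    rewrite sdn_push -spush_push; congr (spush _ _ _).
    by apply: funext => v; rewrite /botmx mul_mx_row mulmx1 mulmx0.
  - case: k s {x} => [|k] s /=; first by rewrite cyl0 raddf0.
    rewrite {1}/idaff /aff_bd flift_gen !raddf_sum/= /sing_bd flift_gen raddf_sum/=.
    apply: eq_bigr => i _; rewrite !raddfMz/= gen_row'1 cyl_push -spush_push.
    rewrite /Cyl flift_gen; congr (spush _ _ _ *~ _).
    by apply: funext => v; rewrite Hnat.
elim/free_ind: x => [|//|x y Hx Hy|x Hx].
- by rewrite !raddf0 ?addr0.
- rewrite !raddfD/= Hx Hy; rewrite addrACA; congr (_ + _); exact: addrACA.
- rewrite [Cyl N (- x)]raddfN [sing_bd (- _)]raddfN/= Hx [topF (- x)]raddfN.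
  rewrite [botF (- x)]raddfN [SdF _ _ (- _)]raddfN [CylB N (- _)]raddfN/=.
  by rewrite !opprD.
Qed.

Definition cylinder k : set 'rV[R]_(k.+1 + 1) :=
  [set v | @stdsimplex R k (lsubmx v) /\ 0 <= rsubmx v ord0 ord0 <= 1].

Lemma hull_closed_cylinder k : hull_closed (@cylinder k).
Proof.
move=> n w t tb wC; split.
  rewrite -mulmx_lsub; apply: hull_closed_stdsimplex => // i.
  rewrite (_ : row i _ = lsubmx (row i w)); first by case: (wC i).
  by apply/rowP => j; rewrite !mxE.
rewrite -mulmx_rsub mxE; have [t0 t1] := tb.
have w01 i : 0 <= rsubmx w i ord0 <= 1.
  by have [_] := wC i; rewrite !mxE.
apply/andP; split; first by apply: sumr_ge0 => i _; rewrite mulr_ge0//; case/andP: (w01 i).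
rewrite -t1; apply: ler_sum => i _; rewrite -[leRHS]mulr1; apply: ler_wpM2l => //.
by case/andP: (w01 i).
Qed.

Lemma supp_Cyl (A : set Y1) (B : set Y2) (y1 : Y1) N k (x : {freeg smp R Y1 k}) :
  (forall s : smp R Y1 k, simp y1 A s -> {within @cylinder k, continuous (H s)} /\
    forall v, cylinder v -> B (H s v)) ->
  supp (simp y1 A) x -> supp (simp y2 B) (Cyl N x).
Proof.
move=> AB; apply: supp_flift => s /AB[Hc HB].
apply: (supp_spush y2 (@hull_closed_cylinder k)) => //.
apply: (@supp_cyl _ _ _ _ (@stdsimplex R k)) => //.
- exact: hull_closed_cylinder.
- move=> v vS; split; rewrite /cylinder/= ?row_mxKl ?row_mxKr; split => //.
    by rewrite mxE ler01 lexx.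
  by rewrite mxE ler01 lexx.
- by rewrite /idaff; apply: supp_gen; exact: rows_in_1.
Qed.

End Cylinder.

(** * From a chain map into [susp_minus] to vanishing relative homology *)

Section Suspension.
Variables (R : realType) (X : topologicalType) (x : X) (U : set X) (k : nat).
Hypothesis closed_x : closed [set x].

Local Notation V := (X * R)%type.
Local Notation v0 := ((x, 0) : V).

Definition susp : set V := [set y | U y.1].
Definition susp_minus : set V := [set y | U y.1 /\ ~ (y.1 = x /\ y.2 = 0)].
Definition susp_off : set V := [set y | (U `\ x) y.1].
Definition susp_pos : set V := [set y | U y.1 /\ 0 < y.2].
Definition susp_neg : set V := [set y | U y.1 /\ y.2 < 0].

Variable r : forall m, smp R V m -> smp R V m.
Hypothesis r_minus : forall m (s : smp R V m), (m <= k.+1)%N ->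
  sing_in susp s -> sing_in susp_minus (r s).
Hypothesis r_id : forall m (s : smp R V m) t, (m <= k.+1)%N ->
  sing_in susp_minus s -> @stdsimplex R m t -> r s t = s t.
Hypothesis r_face : forall m (s : smp R V m.+1) i t, (m < k.+1)%N ->
  sing_in susp s -> @stdsimplex R m t ->
  r s (face_map i t) = r (s \o face_map i : smp R V m) t.

Definition rF m : {freeg smp R V m} -> {freeg smp R V m} :=
  flift (fun s : smp R V m => sg v0 (r s)).
HB.instance Definition _ m := GRing.Additive.on (@rF m).

Lemma supp_rF m (z : {freeg smp R V m}) : (m <= k.+1)%N ->
  supp (simp v0 susp) z -> supp (simp v0 susp_minus) (rF z).
Proof.
move=> mk; apply: supp_flift => s [_ sV]; apply: supp_sg; exact: r_minus.
Qed.

Lemma rF_id m (z : {freeg smp R V m}) : (m <= k.+1)%N ->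
  supp (simp v0 susp_minus) z -> rF z = z.
Proof.
move=> mk; elim=> {z} [|s [sc sW]|y z _ IHy _ IHz|y _ IHy].
- by rewrite raddf0.
- rewrite /rF flift_gen -[in RHS]sc; apply: eq_sg => t tS; exact: r_id.
- by rewrite raddfD/= IHy IHz.
- by rewrite raddfN/= IHy.
Qed.

Lemma rF_bd m (z : {freeg smp R V m.+1}) : (m < k.+1)%N ->
  supp (simp v0 susp) z -> sing_bd (rF z) = rF (sing_bd z).
Proof.
move=> mk; elim=> {z} [|s [sc sV]|y z _ IHy _ IHz|y _ IHy].
- by rewrite !raddf0.
- rewrite {1}/rF flift_gen sing_bd_sg /sing_bd flift_gen raddf_sum/=.
  apply: eq_bigr => i _; rewrite raddfMz/= /rF flift_gen; congr (_ *~ _).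
  by apply: eq_sg => t tS /=; rewrite r_face.
- by rewrite !raddfD/= IHy IHz.
- by rewrite !raddfN/= IHy.
Qed.

Definition prF m : {freeg smp R V m} -> {freeg smp R X m} :=
  flift (fun s : smp R V m => sg x (fst \o s)).
HB.instance Definition _ m := GRing.Additive.on (@prF m).

Lemma prF_sg m (s : smp R V m) : prF (sg v0 s) = sg x (fst \o s).
Proof.
rewrite /prF flift_gen; apply: eq_sg => t tS /=.
by rewrite /canon; case: asboolP.
Qed.

Lemma prF_bd m (z : {freeg smp R V m.+1}) : prF (sing_bd z) = sing_bd (prF z).
Proof.
elim/free_ind: z => [|s|y z Hy Hz|y Hy];
  rewrite ?raddf0// ?raddfD ?raddfN/= ?Hy ?Hz//.
rewrite /prF flift_gen sing_bd_sg /sing_bd flift_gen raddf_sum/=.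
by apply: eq_bigr => i _; rewrite raddfMz/= flift_gen.
Qed.

Lemma prF_SdF N m (z : {freeg smp R V m}) :
  prF (SdF v0 N z) = SdF x N (prF z).
Proof.
elim/free_ind: z => [|s|y z Hy Hz|y Hy];
  rewrite ?raddf0// ?raddfD ?raddfN/= ?Hy ?Hz//.
rewrite [prF (gen s)]flift_gen SdF_sg /SdF flift_gen.
elim/free_ind: (sdn N _) => [|w|y z Hy Hz|y Hy];
  rewrite ?raddf0// ?raddfD ?raddfN/= ?Hy ?Hz//.
by rewrite !spush_gen prF_sg.
Qed.

Lemma supp_prF (B : set V) (A : set X) m (z : {freeg smp R V m}) :
  (forall y, B y -> A y.1) -> supp (simp v0 B) z -> supp (simp x A) (prF z).
Proof.
move=> BA; apply: supp_flift => s [_ [cs sB]]; apply: supp_sg; split.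
  apply: (@within_continuous_comp _ _ _ _ s fst) cs => y _; exact: cvg_fst.
by move=> _ [t tS <-]; apply: BA; apply: sB; exists t.
Qed.

(** The height in [[0, 1]] is recentered, which puts the top of the cylinder in [u > 0] and the
    bottom in [u < 0]. *)
Definition susp_cyl m (s : smp R X m) (v : 'rV[R]_(m.+1 + 1)) : V :=
  (s (lsubmx v), rsubmx v ord0 ord0 - 2^-1).

Definition const_cyl m (s : smp R X m) (v : 'rV[R]_(m.+1 + 1)) : X :=
  s (lsubmx v).

Lemma lsubmx_cylmx d d' (v : 'rV[R]_(d + 1)) (a : 'M[R]_(d, d')) :
  lsubmx (v *m cylmx a) = lsubmx v *m a.
Proof.
rewrite -[v in LHS]hsubmxK /cylmx mul_row_block row_mxKl.
by rewrite mulmx0 addr0.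
Qed.

Lemma rsubmx_cylmx d d' (v : 'rV[R]_(d + 1)) (a : 'M[R]_(d, d')) :
  rsubmx (v *m cylmx a) = rsubmx v.
Proof.
rewrite -[v in LHS]hsubmxK /cylmx mul_row_block row_mxKr.
by rewrite mulmx0 add0r mulmx1.
Qed.

Lemma const_cyl_nat m (s : smp R X m.+1) i v :
  const_cyl (s \o face_map i : smp R X m) v =
  const_cyl s (v *m cylmx (row' i (1%:M : 'M[R]_m.+2))).
Proof. by rewrite /const_cyl/= lsubmx_cylmx face_mapE. Qed.

Lemma susp_cyl_nat m (s : smp R X m.+1) i v :
  susp_cyl (s \o face_map i : smp R X m) v =
  susp_cyl s (v *m cylmx (row' i (1%:M : 'M[R]_m.+2))).
Proof. by rewrite /susp_cyl/= lsubmx_cylmx rsubmx_cylmx face_mapE. Qed.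

Lemma continuous_lsubmx m : continuous (fun v : 'rV[R]_(m.+1 + 1) => lsubmx v).
Proof.
move=> v; apply: (@cvg_rV _ _ (nbhs v)) => j; rewrite mxE.
under eq_fun do rewrite mxE; exact: coord_continuous.
Qed.

Lemma const_cyl_ok (A : set X) m (s : smp R X m) : simp x A s ->
  {within @cylinder R m, continuous (const_cyl s)} /\
  forall v, cylinder v -> A (const_cyl s v).
Proof.
move=> [_ [cs sA]]; split; last by move=> v [vS _]; apply: sA; exists (lsubmx v).
apply: (@within_comp _ _ _ _ (@stdsimplex R m)) cs; last by move=> v [].
by apply: continuous_subspaceT; exact: continuous_lsubmx.
Qed.

Lemma susp_cyl_ok (A : set X) m (s : smp R X m) : simp x A s ->
  {within @cylinder R m, continuous (susp_cyl s)} /\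
  forall v, cylinder v -> [set y : V | A y.1] (susp_cyl s v).
Proof.
move=> /const_cyl_ok[cs sA]; split=> //; apply: within_pair => //.
apply: continuous_subspaceT => v; apply: (@cvgB R R^o _ (nbhs v)); last exact: cvg_cst.
by rewrite mxE; under eq_fun do rewrite mxE; exact: coord_continuous.
Qed.

Lemma stdsimplex_cyl_top m (t : 'rV[R]_m.+1) : @stdsimplex R m t ->
  @cylinder R m (topmx t).
Proof. by move=> tS; split; rewrite ?row_mxKl// row_mxKr mxE ler01 lexx. Qed.

Lemma stdsimplex_cyl_bot m (t : 'rV[R]_m.+1) : @stdsimplex R m t ->
  @cylinder R m (botmx t).
Proof. by move=> tS; split; rewrite ?row_mxKl// row_mxKr mxE ler01 lexx. Qed.

Lemma cvg_mulmx_row d d' (c : 'rV[R]_d') :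
  continuous (fun t : 'rV[R]_d => row_mx t c).
Proof.
move=> t; apply: (@cvg_rV _ _ (nbhs t)) => j; rewrite mxE.
under eq_fun do rewrite mxE; case: (fintype.split j) => l.
  exact: coord_continuous.
exact: cvg_cst.
Qed.

Lemma supp_susp_top m (C : {freeg smp R X m}) : supp (simp x U) C ->
  supp (simp v0 susp_pos) (topF v0 (@susp_cyl) C).
Proof.
apply: supp_flift => s /susp_cyl_ok[cs sA]; apply: supp_sg; split.
  apply: (within_comp _ (@stdsimplex_cyl_top m) cs).
  by apply: continuous_subspaceT; exact: cvg_mulmx_row.
move=> _ [t tS <-]; split; first exact: sA (stdsimplex_cyl_top tS).
by rewrite /= row_mxKr mxE; lra.
Qed.

Lemma supp_susp_bot m (C : {freeg smp R X m}) : supp (simp x U) C ->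
  supp (simp v0 susp_neg) (botF v0 (@susp_cyl) C).
Proof.
apply: supp_flift => s /susp_cyl_ok[cs sA]; apply: supp_sg; split.
  apply: (within_comp _ (@stdsimplex_cyl_bot m) cs).
  by apply: continuous_subspaceT; exact: cvg_mulmx_row.
move=> _ [t tS <-]; split; first exact: sA (stdsimplex_cyl_bot tS).
by rewrite /= row_mxKr mxE; lra.
Qed.

Lemma rel_cycle_CylB (Y : topologicalType) (y0 : Y)
    (H : forall m, smp R X m -> 'rV[R]_(m.+1 + 1) -> Y) (B : set Y) N
    (c : chain R X k) :
  (forall m (s : smp R X m), simp x (U `\ x) s ->
    {within @cylinder R m, continuous (H m s)} /\
    forall v, cylinder v -> B (H m s v)) ->
  rel_cycle (U `\ x) c -> supp (simp y0 B) (CylB y0 H N (of_chain x c)).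
Proof.
move=> HB; case: k c => [|k'] c /=; first by move=> _; exact: supp0.
move=> [e eA /(chain_eqvP x)]; rewrite of_chain_boundary => ->.
apply: (@supp_Cyl _ _ _ _ _ (U `\ x) B x) => [s|]; first exact: HB.
exact: supp_of_chain.
Qed.

(** A simplex has a vertex, so it cannot lie in both halves. *)
Lemma simp_pos_off m (s : smp R V m) :
  simp v0 susp_pos s -> simp v0 susp_off s \/ simp v0 susp_neg s ->
  simp v0 susp_off s.
Proof.
move=> [_ [_ sp]] [//|[_ [_ sn]]].
have tS : @stdsimplex R m (delta_mx ord0 ord0) by exact: barycoord_delta.
have [_ p] : susp_pos (s (delta_mx ord0 ord0)) by apply: sp; eexists; first exact: tS.
have [_ n] : susp_neg (s (delta_mx ord0 ord0)) by apply: sn; eexists; first exact: tS.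
by have := lt_trans p n; rewrite ltxx.
Qed.

Lemma open_off : open [set y : V | y.1 <> x].
Proof.
apply: (@open_comp _ _ (fst : V -> X) (~` [set x])).
  by move=> y _; exact: cvg_fst.
exact: closed_openC.
Qed.

Lemma susp_rel_homology_trivial : rel_homology_trivial R U (U `\ x) k.
Proof.
move=> c cU cA; pose C := of_chain x c.
have CU : supp (simp x U) C by exact: supp_of_chain.
have UxU : U `\ x `<=` U by move=> y [].
pose z := Cyl v0 (@susp_cyl) 0 C.
have zV : supp (simp v0 susp) z.
  by apply: supp_Cyl CU => s; exact: susp_cyl_ok.
pose Bd := CylB v0 (@susp_cyl) 0 C.
have BdA : supp (simp v0 susp_off) Bd.
  by apply: rel_cycle_CylB cA => m s; exact: susp_cyl_ok.
pose tp := topF v0 (@susp_cyl) C; pose bt := SdF v0 0 (botF v0 (@susp_cyl) C).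
have tpP : supp (simp v0 susp_pos) tp by exact: supp_susp_top.
have btN : supp (simp v0 susp_neg) bt by apply: supp_SdF; exact: supp_susp_bot.
have posW : susp_pos `<=` susp_minus.
  by move=> y [Uy y0]; split=> // -[_ yE]; rewrite yE ltxx in y0.
have negW : susp_neg `<=` susp_minus.
  by move=> y [Uy y0]; split=> // -[_ yE]; rewrite yE ltxx in y0.
have offW : susp_off `<=` susp_minus by move=> y [Uy yx]; split=> // -[].
(* All three parts of the boundary of [z] lie in [susp_minus] already, where [rF] is the identity;
   only the interior of [z] is moved. *)
have z'bd : sing_bd (rF z) = tp - bt - Bd.
  rewrite rF_bd// bd_Cyl; last exact: susp_cyl_nat.
  rewrite rF_id//; apply: suppB; first apply: suppB.
  - by apply: sub_supp tpP => s; exact: simp_sub.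
  - by apply: sub_supp btN => s; exact: simp_sub.
  - by apply: sub_supp BdA => s; exact: simp_sub.
pose O (i : option bool) : set V := match i with
  | None => [set y | y.1 <> x]
  | Some true => [set y | 0 < y.2]
  | Some false => [set y | y.2 < 0]
  end.
have [|||N /(_ N (leqnn N)) yO] := @SdF_small R V v0 _ O susp_minus k.+1 (rF z).
- case=> [[]|]; last exact: open_off.
    apply: (@open_comp _ _ (snd : V -> R) [set a | 0 < a]) => [y _|].
      exact: cvg_snd.
    exact: open_gt.
  apply: (@open_comp _ _ (snd : V -> R) [set a | a < 0]) => [y _|].
    exact: cvg_snd.
  exact: open_lt.
- move=> y [Uy yp]; have [yx|yx] := pselect (y.1 = x); last by exists None.
  have : y.2 != 0 by apply/eqP => y0; exact: yp.
  by case/lt_total/orP => y0; [exists (Some false)|exists (Some true)].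
- exact: supp_rF.
set y := SdF v0 N (rF z) in yO.
(* A small simplex may lie in several of the open sets; it is counted in [b] as soon as [u > 0] on
   it. *)
pose b := flift (fun s : smp R V k.+1 =>
  if `[< simp v0 susp_pos s >] then gen s else 0) y.
have bP : supp (simp v0 susp_pos) b.
  apply: supp_flift yO => s _; case: asboolP => sP; last exact: supp0.
  exact: supp_gen.
have ybN : supp (fun s => simp v0 susp_off s \/ simp v0 susp_neg s) (y - b).
  rewrite /b; elim: yO => [|s [i si]|y1 y2 _ H1 _ H2|y1 _ H1].
  - by rewrite raddf0 subr0; exact: supp0.
  - rewrite flift_gen; case: asboolP => sP; first by rewrite subrr; exact: supp0.
    rewrite subr0; apply: supp_gen; case: i si => [[]|] si.
    + by exfalso; apply: sP; apply: simp_sub si => a [/= ? []].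
    + by right; apply: simp_sub si => a [/= ? []].
    + by left; apply: simp_sub si => a [/= ? []].
  - by rewrite raddfD/= opprD addrACA; exact: suppD.
  - by rewrite raddfN/= -opprD; exact: suppN.
have ybd : sing_bd y = SdF v0 N tp - SdF v0 N bt - SdF v0 N Bd.
  by rewrite SdF_bd z'bd !raddfB.
pose E := sing_bd b - SdF v0 N tp.
have EP : supp (simp v0 susp_pos) E.
  by apply: suppB; [exact: supp_sing_bd|exact: supp_SdF].
(* The same chain seen from the other side: up to sign it is the boundary of [y - b] plus the
   subdivided bottom and lateral parts, all supported in [susp_off] or [susp_neg]. *)
have EN : supp (fun s => simp v0 susp_off s \/ simp v0 susp_neg s) E.
  have -> : E = - (sing_bd (y - b) + SdF v0 N bt + SdF v0 N Bd).
    rewrite raddfB/= ybd /E; set p := SdF _ _ tp; set q := SdF _ _ bt.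
    rewrite [p - q - _ - _]addrAC [_ - _ + q]addrAC subrK.
    by rewrite [p - q - _]addrAC subrK opprB.
  apply: suppN; apply: suppD; first apply: suppD.
  - elim: ybN => [|s sON|y1 y2 _ H1 _ H2|y1 _ H1].
    + by rewrite raddf0; exact: supp0.
    + by case: sON => sO; [have /supp_sing_bd : supp (simp v0 susp_off) (gen s)
         by exact: supp_gen|have /supp_sing_bd : supp (simp v0 susp_neg) (gen s)
         by exact: supp_gen]; apply: sub_supp => ? ?; [left|right].
    + by rewrite raddfD; exact: suppD.
    + by rewrite raddfN; exact: suppN.
  - by apply: sub_supp (supp_SdF N btN) => s; right.
  - by apply: sub_supp (supp_SdF N BdA) => s; left.
have EA : supp (simp v0 susp_off) E.
  by apply: sub_supp (suppI EP EN) => s [] ; exact: simp_pos_off.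
(* The projection of the top [tp] is [C]. So [prF b] bounds the subdivided [C] up to [prF E], a
   chain avoiding [x]. *)
have prE : SdF x N C = sing_bd (prF b) - prF E.
  rewrite /E raddfB/= prF_bd opprB addrCA subrr addr0 prF_SdF; congr SdF.
  rewrite /tp; elim: CU => [|s [sc _]|y1 y2 _ H1 _ H2|y1 _ H1].
  - by rewrite !raddf0.
  - rewrite /topF flift_gen prF_sg -[in LHS]sc; apply: eq_sg => t _ /=.
    by rewrite row_mxKl.
  - by rewrite !raddfD/= -H1 -H2.
  - by rewrite !raddfN/= -H1.
(* Both ends of the constant cylinder over [C] are [C]; the prism formula then compares [C] with its
   subdivision. *)
have cstE (f : 'rV[R]_k.+1 -> 'rV[R]_(k.+1 + 1)) :
    (forall t, lsubmx (f t) = t) ->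
    flift (fun s : smp R X k => sg x (fun t => const_cyl s (f t))) C = C.
  move=> fK; elim: CU => [|s [sc _]|y1 y2 _ H1 _ H2|y1 _ H1].
  - by rewrite !raddf0.
  - by rewrite flift_gen -[in RHS]sc; apply: eq_sg => t _; rewrite /const_cyl fK.
  - by rewrite !raddfD/= H1 H2.
  - by rewrite !raddfN/= H1.
have := bd_Cyl x const_cyl_nat N C.
rewrite /topF /botF (cstE (@topmx R k.+1 1)) => [|t]; last by rewrite row_mxKl.
rewrite (cstE (@botmx R k.+1 1)) => [|t]; last by rewrite row_mxKl.
rewrite prE => CE.
pose D := Cyl x (@const_cyl) N C + prF b.
pose A := CylB x (@const_cyl) N C - prF E.
have DU : supp (simp x U) D.
  apply: suppD; last by apply: supp_prF bP => ? [].
  by apply: supp_Cyl CU => s; exact: const_cyl_ok.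
have AU : supp (simp x (U `\ x)) A.
  apply: suppB; last by apply: supp_prF EA.
  by apply: rel_cycle_CylB cA => m s; exact: const_cyl_ok.
have [d dU dE] := chain_of_supp DU; have [a aU aE] := chain_of_supp AU.
exists d, a; split=> //; apply/(chain_eqvP x).
rewrite of_chain_cat of_chain_boundary dE aE raddfD/= CE -/C /A.
set p := CylB _ _ _ _; set q := sing_bd _; set w := prF E.
by rewrite opprB !addrA [C + w - q - p]addrAC subrK subrK addrK.
Qed.

End Suspension.

Section CvgMinMax.
Context {R : realType} {T : Type} {F : set_system T} {FF : Filter F}.

Lemma cvg_maxr (f g : T -> R) a b : f x @[x --> F] --> a -> g x @[x --> F] --> b ->
  Num.max (f x) (g x) @[x --> F] --> Num.max a b.
Proof.
move=> fa gb; under eq_fun do rewrite maxr_absE; rewrite maxr_absE.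
apply: cvgM; last exact: cvg_cst.
by apply: cvgD; [exact: cvgD|apply: cvg_norm; exact: cvgB].
Qed.

Lemma cvg_minr (f g : T -> R) a b : f x @[x --> F] --> a -> g x @[x --> F] --> b ->
  Num.min (f x) (g x) @[x --> F] --> Num.min a b.
Proof.
move=> fa gb; under eq_fun do rewrite minr_absE; rewrite minr_absE.
apply: cvgM; last exact: cvg_cst.
by apply: cvgB; [exact: cvgD|apply: cvg_norm; exact: cvgB].
Qed.

End CvgMinMax.

(** * Uniform bounds on compact sets *)

Section CompactTools.
Variable R : realType.

(** Compactness in its near-covering form, for the filter of small positive [e]. *)
Lemma compact_uniform (T : topologicalType) (K : set T) (P : R -> T -> Prop) :
  compact K ->
  (forall z, K z -> exists2 d : R, 0 < d & \forall z' \near within K (nbhs z),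
    forall e, 0 < e -> e < d -> P e z') ->
  exists2 e : R, 0 < e & forall z, K z -> P e z.
Proof.
move=> /compact_near_coveringP/near_covering_withinP cK KP.
have : \forall e \near (0 : R)^'+, K `<=` P e.
  apply: cK => z Kz; have [d d0 dP] := KP _ Kz.
  exists ([set z' | K z' -> forall e, 0 < e -> e < d -> P e z'],
          [set e | 0 < e < d]) => /=.
    split; first exact: dP.
    near=> e; apply/andP; split; near: e; first exact: nbhs_right_gt.
    exact: nbhs_right_lt.
  by move=> [z' e]/= [zP /andP[e0 ed]] Kz'; exact: zP.
move=> KPe; have [e [/= e0 eP]] := filter_ex (filterI (nbhs_right_gt (0 : R)) KPe).
by exists e.
Unshelve. all: by end_near. Qed.

Lemma compact_pos_lbound (T : topologicalType) (K : set T) (f : T -> R) :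
  compact K -> {within K, continuous f} -> (forall z, K z -> 0 < f z) ->
  exists2 c : R, 0 < c & forall z, K z -> c <= f z.
Proof.
move=> cK /subspace_continuousP cf f0.
apply: (@compact_uniform _ _ (fun c z => c <= f z)) => // z Kz.
exists (f z / 2); first by rewrite divr_gt0// f0.
have fz2 : f z / 2 < f z by rewrite ltr_pdivrMr// ltr_pMr ?f0// ltr1n.
have : \forall z' \near within K (nbhs z), f z / 2 < f z'.
  exact: (cf _ Kz _ (open_nbhs_nbhs (conj (@open_gt R (f z / 2)) fz2))).
by apply: filterS => z' fz' e _ /ltW/le_trans; apply; exact: ltW.
Qed.

Lemma closed_within (T S : topologicalType) (A : set T) (f : T -> S) (C : set S) :
  closed A -> {within A, continuous f} -> closed C -> closed (A `&` f @^-1` C).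
Proof.
by move=> cA /continuous_closedP cf cC; rewrite closed_setSI//; exact: cf.
Qed.

Lemma continuous_mdistl (X : metricType R) (x : X) :
  continuous (fun y : X => mdist y x).
Proof.
move=> y; apply/cvgrPdist_lt => e e0; near=> z.
have yz : mdist y z < e.
  have : ball y e z by near: z; exact: nbhsx_ballx.
  by rewrite ballEmdist.
apply: le_lt_trans yz; rewrite ler_norml; apply/andP; split.
  rewrite lerBrDr addrC lerBlDr [mdist y z]metric_sym addrC.
  exact: metric_triangle.
by rewrite lerBlDr; exact: metric_triangle.
Unshelve. all: by end_near. Qed.

End CompactTools.

(** * The simplex as a retract of Euclidean space through a cube *)

Section SimplexInCube.
Variables (R : realType) (m p : nat).

(** Coordinate [0] is determined by the others on the simplex and is dropped. The [p] zeros raise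
    the dimension to that of the cube for which AP is assumed. *)
Definition to_cube (z : 'rV[R]_m.+1) : 'rV[R]_(m + p) :=
  row_mx (\row_j z ord0 (lift ord0 j)) 0.

Let pos (q : 'rV[R]_(m + p)) (j : 'I_m) := Num.max 0 (q ord0 (lshift p j)).
Let tot q := \sum_j pos q j.

(** Negative coordinates are cut to [0] and a total above [1] is scaled back to [1]. Being defined
    and continuous everywhere, it turns functions continuous on the simplex into functions
    continuous on the whole space. *)
Definition of_cube (q : 'rV[R]_(m + p)) : 'rV[R]_m.+1 :=
  \row_i (if unlift ord0 i is Some j then pos q j / Num.max 1 (tot q)
          else 1 - tot q / Num.max 1 (tot q)).

Let tot_ge0 q : 0 <= tot q.
Proof. by apply: sumr_ge0 => j _; rewrite le_max lexx. Qed.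

Let max_gt0 q : 0 < Num.max 1 (tot q).
Proof. by rewrite lt_max ltr01. Qed.

Lemma of_cube_stdsimplex q : @stdsimplex R m (of_cube q).
Proof.
split=> [i|].
  rewrite mxE; case: unlift => [j|].
    by apply: divr_ge0; [rewrite /pos le_max lexx|exact: ltW].
  by rewrite subr_ge0 ler_pdivrMr// mul1r le_max lexx orbT.
rewrite big_ord_recl mxE unlift_none.
under eq_bigr do rewrite mxE liftK.
by rewrite -mulr_suml subrK.
Qed.

Lemma to_cubeK z : @stdsimplex R m z -> of_cube (to_cube z) = z.
Proof.
move=> [z0 z1].
have posE j : pos (to_cube z) j = z ord0 (lift ord0 j).
  by rewrite /pos /to_cube row_mxEl mxE max_r.
have totE : tot (to_cube z) = 1 - z ord0 ord0.
  rewrite /tot; under eq_bigr do rewrite posE.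
  by rewrite -z1 big_ord_recl [RHS]addrC addKr.
have -> : of_cube (to_cube z) = \row_i
    (if unlift ord0 i is Some j then z ord0 (lift ord0 j) else z ord0 ord0).
  have z01 : 1 - z ord0 ord0 <= 1 by rewrite gerBl.
  apply/rowP => i; rewrite !mxE; case: unlift => [j|]; rewrite totE max_l// divr1.
    exact: posE.
  by rewrite subKr.
by apply/rowP => i; rewrite mxE; case: unliftP => [j ->|->].
Qed.

Lemma to_cube_unit z : @stdsimplex R m z -> @unit_cube R (m + p) (to_cube z).
Proof.
move=> zS i; rewrite /to_cube mxE; case: fintype.split => j; rewrite mxE.
  by rewrite stdsimplex_le1// andbT; case: zS.
by rewrite lexx ler01.
Qed.

Lemma continuous_to_cube : continuous to_cube.
Proof.
move=> z; apply: (@cvg_rV _ _ (nbhs z)) => j; rewrite mxE.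
under eq_fun do rewrite mxE; case: fintype.split => l; rewrite mxE.
  by under eq_fun do rewrite mxE; exact: coord_continuous.
exact: cvg_cst.
Qed.

Lemma continuous_of_cube : continuous of_cube.
Proof.
have cpos j : continuous (pos^~ j).
  by move=> q; apply: (@cvg_maxr R _ (nbhs q)); [exact: cvg_cst|exact: coord_continuous].
have ctot : continuous tot.
  by move=> q; apply: (@cvg_sumr _ _ (nbhs q)) => j; exact: cpos.
have cmax : continuous (fun q => (Num.max 1 (tot q))^-1).
  move=> q; apply: (@cvgV _ _ (nbhs q)); first by rewrite gt_eqF.
  by apply: (@cvg_maxr R _ (nbhs q)); [exact: cvg_cst|exact: ctot].
move=> q; apply: (@cvg_rV _ _ (nbhs q)) => i; rewrite mxE.
under eq_fun do rewrite mxE; case: unlift => [j|].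
  by apply: cvgM; [exact: cpos|exact: cmax].
apply: (@cvgB R R^o _ (nbhs q)); first exact: cvg_cst.
by apply: cvgM; [exact: ctot|exact: cmax].
Qed.

End SimplexInCube.

(** * Approximation of singular simplices *)

Section ApproximateSimplex.
Variables (R : realType) (X : metricType R).

(** All that is kept of 0-dimensionality of the fiber over [x]: the cover by [|u| < d] and [u != 0]
    is refined to a partition into two closed sets. *)
Definition splits_off m (z1 : 'rV[R]_m.+1 -> X) (x : X) :=
  forall (u : 'rV[R]_m.+1 -> R) d, 0 < d -> {within @stdsimplex R m, continuous u} ->
  exists C0 C1 : set 'rV[R]_m.+1,
    [/\ closed C0, closed C1, C0 `&` C1 = set0,
        forall z, @stdsimplex R m z -> z1 z = x -> C0 z \/ C1 z &
        [/\ forall z, C0 z -> [/\ @stdsimplex R m z, z1 z = x & `|u z| < d] &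
            forall z, C1 z -> u z != 0]].

Lemma AP_simplex n m (f : 'rV[R]_m.+1 -> X) eps : AP_n0 X n -> (m <= n)%N ->
  0 < eps -> {within @stdsimplex R m, continuous f} ->
  exists h : 'rV[R]_m.+1 * R -> X,
    [/\ {within @stdsimplex R m `*` `[0, 1], continuous h},
        forall z, @stdsimplex R m z -> h (z, 0) = f z,
        forall z s, @stdsimplex R m z -> 0 <= s <= 1 -> mdist (f z) (h (z, s)) < eps &
        forall x, splits_off (fun z => h (z, 1)) x].
Proof.
move=> APX mn eps0 cf.
rewrite -(subnKC mn) in APX; set p := (n - m)%N in APX.
have cg : {within @unit_cube R (m + p), continuous (f \o @of_cube R m p)}.
  apply: (within_comp _ _ cf); last by move=> q _; exact: of_cube_stdsimplex.
  by apply: continuous_subspaceT; exact: continuous_of_cube.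
have [g' [cg' zg' [h [ch h0 h1 hd]]]] := APX _ _ eps0 cg.
exists (fun zs => h (to_cube p zs.1, zs.2)); split.
- apply: (within_comp _ _ ch) => [|[z s] [zS s01]]; last first.
    by split => //=; exact: to_cube_unit.
  apply: within_pair; apply: continuous_subspaceT => zs; last exact: cvg_snd.
  apply: (@continuous_comp _ _ _ fst (@to_cube R m p)); first exact: cvg_fst.
  exact: continuous_to_cube.
- by move=> z zS /=; rewrite h0 /= ?to_cubeK//; exact: to_cube_unit.
- move=> z s zS s01; have zC := @to_cube_unit R m p _ zS.
  have [d de dh] := hd _ zC; apply: le_lt_trans de.
  have <- : h (to_cube p z, 0) = f z by rewrite h0//= to_cubeK.
  apply: dh; first by exists 0 => //=; rewrite in_itv/= lexx ler01.
  by exists s => //=; rewrite in_itv.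
move=> x u d d0 cu; pose v := u \o @of_cube R m p.
have cv : continuous v.
  move=> q; have := within_comp (continuous_subspaceT (A := setT)
    (@continuous_of_cube R m p)) (fun q _ => of_cube_stdsimplex q) cu.
  by move=> /(_ q); rewrite /continuous_at nbhs_subspaceT.
pose O1 : set 'rV[R]_(m + p) := [set q | `|v q| < d].
pose O2 : set 'rV[R]_(m + p) := [set q | v q != 0].
have oO1 : open O1.
  apply: (@open_comp _ _ v [set a | `|a| < d]) => [q _|]; first exact: cv.
  apply: (@open_comp _ _ (fun a : R => `|a|) [set a | a < d]) => [a _|].
    exact: norm_continuous.
  exact: open_lt.
have oO2 : open O2.
  by apply: (@open_comp _ _ v [set a | a != 0]) => [q _|]; [exact: cv|exact: open_neq].
pose D := @unit_cube R (m + p) `&` g' @^-1` [set x].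
have [||Vs [oV VO DV Vdisj]] := zg' x [:: O1; O2].
- by move=> W; rewrite !inE => /orP[]/eqP ->.
- move=> q _; have [vq|vq] := eqVneq (v q) 0.
    by exists O1; rewrite /= ?inE ?eqxx// /O1/= vq normr0.
  by exists O2; rewrite /= ?inE ?eqxx ?orbT.
(* The members of the refinement are sorted, by index, into those inside [O1] and the others, which
   must lie in [O2]. Distinct members are disjoint on [D], so [V1] and [V2] partition [D]. *)
pose V1 := \bigcup_(i in [set i | (i < size Vs)%N /\ nth set0 Vs i `<=` O1]) nth set0 Vs i.
pose V2 := \bigcup_(i in [set i | (i < size Vs)%N /\ ~ nth set0 Vs i `<=` O1]) nth set0 Vs i.
have oV1 : open V1 by apply: bigcup_open => i [iV _]; apply: oV; exact: mem_nth.
have oV2 : open V2 by apply: bigcup_open => i [iV _]; apply: oV; exact: mem_nth.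
have V12 : D `<=` V1 `|` V2.
  move=> q /DV[W /= WV Wq]; have iW := nth_index set0 WV.
  have [sW|sW] := pselect (W `<=` O1); [left|right]; exists (index W Vs) => //=;
    by rewrite ?iW// index_mem.
have V12D q : D q -> V1 q -> V2 q -> False.
  move=> Dq [i /= [iV si] iq] [j /= [jV sj] jq].
  have ij : i <> j by move=> ij; apply: sj; rewrite -ij.
  have := Vdisj i j iV jV ij.
  by move/seteqP => [/(_ q) + _]; apply; split.
have V2O q : V2 q -> O2 q.
  move=> [i /= [iV si] iq]; have [W] := VO _ (mem_nth set0 iV).
  by rewrite !inE => /orP[]/eqP -> // /(_ _ iq).
have cg2 : {within @stdsimplex R m, continuous (g' \o @to_cube R m p)}.
  apply: (within_comp _ _ cg'); last by move=> z; exact: to_cube_unit.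
  by apply: continuous_subspaceT; exact: continuous_to_cube.
pose Dz := @stdsimplex R m `&` (g' \o @to_cube R m p) @^-1` [set x].
have cDz : closed Dz.
  apply: closed_within => //; first exact: closed_stdsimplex.
  by apply: accessible_closed_set1; apply: hausdorff_accessible; exact: metric_hausdorff.
have DzD z : Dz z -> D (to_cube p z) by move=> [zS gz]; split => //; exact: to_cube_unit.
have cC V : open V -> closed (Dz `&` ~` (@to_cube R m p @^-1` V)).
  move=> oV'; apply: closedI => //; apply: open_closedC.
  by apply: open_comp oV' => z _; exact: continuous_to_cube.
(* Each piece is the fiber minus the open set of the other piece, hence closed. *)
exists (Dz `&` ~` (@to_cube R m p @^-1` V2)), (Dz `&` ~` (@to_cube R m p @^-1` V1)).
split; [exact: cC|exact: cC| | |split].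
- rewrite -subset0 => z [[Dzz nV2] [_ nV1]].
  by case: (V12 _ (DzD _ Dzz)).
- move=> z zS; rewrite h1; last exact: to_cube_unit.
  move=> gz; have Dzz : Dz z by [].
  have [V1z|V1z] := pselect (V1 (to_cube p z)); last by right.
  by left; split => // V2z; exact: V12D (DzD _ Dzz) V1z V2z.
- move=> z [Dzz nV2]; have [zS gz] := Dzz; split => //.
    by rewrite h1//; exact: to_cube_unit.
  case: (V12 _ (DzD _ Dzz)) => // -[i /= [iV si] /si].
  by rewrite /O1/= /v/= to_cubeK.
- move=> z [Dzz nV1]; have [zS gz] := Dzz.
  case: (V12 _ (DzD _ Dzz)) => // /V2O.
  by rewrite /O2/= /v/= to_cubeK.
Qed.

End ApproximateSimplex.

(** * Depth in the simplex and the retraction of the cylinder *)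

Section SimplexDepth.
Variables (R : realType) (m : nat).
Implicit Types z : 'rV[R]_m.+1.

(** The initial value [1] of the minimum does no harm, as coordinates on the simplex are at most
    [1]. *)
Definition low z : R := \big[Num.min/1]_i z ord0 i.

Lemma low_le z i : low z <= z ord0 i.
Proof. exact: bigmin_le. Qed.

Lemma low_ge0 z : @stdsimplex R m z -> 0 <= low z.
Proof. by move=> [z0 _]; apply: le_bigmin. Qed.

Lemma low_attained z : @stdsimplex R m z -> exists i, low z = z ord0 i.
Proof.
move=> zS; have [i _ iE] := @eq_bigmin _ _ _ 1 (@ord0 m) xpredT (z ord0) isT
  (fun i _ => stdsimplex_le1 i zS).
by exists i.
Qed.

Lemma low_eq0 z i : @stdsimplex R m z -> z ord0 i = 0 -> low z = 0.
Proof.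
move=> zS zi; apply/eqP; rewrite eq_le low_ge0// andbT -zi; exact: low_le.
Qed.

Lemma continuous_low : continuous low.
Proof.
move=> z.
suff cbig s : \big[Num.min/1]_(i <- s) (y : 'rV[R]_m.+1) ord0 i @[y --> z] -->
    \big[Num.min/1]_(i <- s) z ord0 i by exact: cbig.
elim: s => [|i s IH].
  under eq_fun do rewrite big_nil; rewrite big_nil.
  exact: (@cvg_cst R 1 _ (nbhs z) _).
under eq_fun do rewrite big_cons; rewrite big_cons.
by apply: (@cvg_minr R _ (nbhs z)) => //; exact: coord_continuous.
Qed.

(* [depth] is [0] exactly on the boundary and [1] at the barycenter. *)
Definition depth z : R := m.+1%:R * low z.

Lemma depth_ge0 z : @stdsimplex R m z -> 0 <= depth z.
Proof. by move=> zS; rewrite mulr_ge0// low_ge0. Qed.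

Lemma depth_eq0 z : @stdsimplex R m z -> depth z = 0 -> exists i, z ord0 i = 0.
Proof.
move=> zS /eqP; rewrite mulf_eq0 pnatr_eq0/= => /eqP l0.
by have [i iE] := low_attained zS; exists i; rewrite -iE.
Qed.

Lemma continuous_depth : continuous depth.
Proof. by move=> z; apply: (@cvgMr R _ (nbhs z)); exact: continuous_low. Qed.

(* Radial projection of the cylinder from a point above its barycentric axis:
   the standard retraction of the cylinder onto its bottom and its lateral face. *)
Definition hep_shift (zs : 'rV[R]_m.+1 * R) : R := Num.min (depth zs.1) (zs.2 / 2).

Definition hep_retract (zs : 'rV[R]_m.+1 * R) : 'rV[R]_m.+1 * R :=
  (\row_i ((zs.1 ord0 i - hep_shift zs / m.+1%:R) / (1 - hep_shift zs)),
   Num.max 0 (zs.2 - 2 * depth zs.1)).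

Definition cyl_set : set ('rV[R]_m.+1 * R) := @stdsimplex R m `*` `[0, 1].

Lemma closed_cyl_set : closed cyl_set.
Proof.
have -> : cyl_set = fst @^-1` (@stdsimplex R m) `&` snd @^-1` `[0, 1]%classic.
  by apply/seteqP; split=> zs [].
apply: closedI.
  by apply: closed_comp => [zs _|]; [exact: cvg_fst|exact: closed_stdsimplex].
by apply: closed_comp => [zs _|]; [exact: cvg_snd|exact: interval_closed].
Qed.

Definition cyl_bdry : set ('rV[R]_m.+1 * R) :=
  [set zs | cyl_set zs /\ (zs.2 = 0 \/ exists i, zs.1 ord0 i = 0)].

(** The upper bound keeps the denominator in [hep_retract] away from [0]. *)
Lemma hep_shift_le zs : cyl_set zs -> 0 <= hep_shift zs <= 2^-1.
Proof.
move=> [zS]; rewrite /= in_itv/= => /andP[s0 s1]; apply/andP; split.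
  by rewrite le_min depth_ge0// divr_ge0.
by rewrite ge_min; apply/orP; right; rewrite -[leRHS]mul1r ler_wpM2r.
Qed.

Lemma hep_retract_bdry zs : cyl_set zs -> cyl_bdry (hep_retract zs).
Proof.
move=> zsC; have /andP[a0 a12] := hep_shift_le zsC.
have a1 : 0 < 1 - hep_shift zs by lra.
have m0 : 0 < m.+1%:R :> R by rewrite ltr0n.
case: zsC => zS; rewrite /= in_itv/= => /andP[s0 s1].
have aD : hep_shift zs <= depth zs.1 by rewrite ge_min lexx.
have aL : hep_shift zs / m.+1%:R <= low zs.1 by rewrite ler_pdivrMr// mulrC.
have nu0 := depth_ge0 zS.
split; first split=> /=.
- split=> [i|]; first by rewrite mxE divr_ge0 ?(ltW a1)// subr_ge0 (le_trans aL)// low_le.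
  under eq_bigr do rewrite mxE.
  have cE : \sum_(i < m.+1) hep_shift zs / m.+1%:R = hep_shift zs.
    by rewrite sumr_const card_ord -[LHS]mulr_natl mulrCA divff ?gt_eqF// mulr1.
  rewrite -mulr_suml sumrB cE.
  by have [_ ->] := zS; rewrite divff ?gt_eqF.
- rewrite in_itv/= le_max lexx/= ge_max ler01/=; lra.
(* If the depth is at most half the height, the shift is the whole depth and annihilates the least
   coordinate; otherwise the new height is [0]. *)
have [h|h] := leP (depth zs.1) (zs.2 / 2); last first.
  by left => /=; rewrite max_l//; lra.
right; have [i iE] := low_attained zS; exists i; rewrite /= mxE.
have -> : hep_shift zs = m.+1%:R * low zs.1 by rewrite /hep_shift min_l.
by rewrite mulrAC divff ?gt_eqF// mul1r iE subrr mul0r.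
Qed.

Lemma hep_retract_id zs : cyl_bdry zs -> hep_retract zs = zs.
Proof.
case: zs => z s [[zS]]; rewrite /= in_itv/= => /andP[s0 s1] b.
have nu0 := depth_ge0 zS.
have aE : hep_shift (z, s) = 0.
  rewrite /hep_shift/=; case: b => [->|[i zi]]; first by rewrite mul0r min_r.
  by rewrite /depth (low_eq0 zS zi) mulr0 min_l// divr_ge0.
rewrite /hep_retract aE; congr (_, _) => /=.
  by apply/rowP => i; rewrite mxE mul0r !subr0 divr1.
case: b => [->|[i zi]]; first by rewrite max_l//; lra.
by rewrite /depth (low_eq0 zS zi) !mulr0 subr0 max_r.
Qed.

Lemma continuous_hep_retract : {within cyl_set, continuous hep_retract}.
Proof.
have cfst (i : 'I_m.+1) : continuous (fun zs : 'rV[R]_m.+1 * R => zs.1 ord0 i).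
  move=> zs; apply: (@continuous_comp _ _ _ fst (fun z : 'rV[R]_m.+1 => z ord0 i)).
    exact: cvg_fst.
  exact: coord_continuous.
have cdep : continuous (fun zs : 'rV[R]_m.+1 * R => depth zs.1).
  move=> zs; apply: (@continuous_comp _ _ _ fst depth); first exact: cvg_fst.
  exact: continuous_depth.
have cshift : continuous hep_shift.
  move=> zs; apply: (@cvg_minr R _ (nbhs zs)); first exact: cdep.
  by apply: (@cvgMl R _ (nbhs zs)); exact: cvg_snd.
apply: within_pair; last first.
  apply: continuous_subspaceT => zs; apply: (@cvg_maxr R _ (nbhs zs)).
    exact: cvg_cst.
  apply: (@cvgB R R^o _ (nbhs zs)); first exact: cvg_snd.
  by apply: (@cvgMr R _ (nbhs zs)); exact: cdep.
apply: continuous_in_subspaceT => zs; rewrite inE => zsC.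
have /andP[a0 a12] := hep_shift_le zsC.
apply: (@cvg_rV _ _ (nbhs zs)) => i; rewrite mxE.
under eq_fun do rewrite mxE.
apply: (@cvgM R _ (nbhs zs)).
  apply: (@cvgB R R^o _ (nbhs zs)); first exact: cfst.
  by apply: (@cvgMl R _ (nbhs zs)); exact: cshift.
apply: (@cvgV _ _ (nbhs zs)); first by rewrite gt_eqF//; lra.
by apply: (@cvgB R R^o _ (nbhs zs)); [exact: cvg_cst|exact: cshift].
Qed.

End SimplexDepth.

(** * Pushing one simplex off [(x, 0)] *)

Section PushOff.
Variables (R : realType) (X : metricType R) (n : nat) (x : X) (U : set X).
Hypothesis APX : AP_n0 X n.
Hypothesis openU : open U.

(* AP approximates [f]; the second coordinate [u] is then moved away from [0]
   on the [0]-dimensional preimage of [x] by adding a bump function [phi]. *)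
Lemma push_off m (f : 'rV[R]_m.+1 -> X) (u : 'rV[R]_m.+1 -> R) : (m <= n)%N ->
  {within @stdsimplex R m, continuous f} ->
  {within @stdsimplex R m, continuous u} ->
  (forall z, @stdsimplex R m z -> U (f z)) ->
  (forall z, @stdsimplex R m z -> depth z = 0 -> ~ (f z = x /\ u z = 0)) ->
  exists (h : 'rV[R]_m.+1 * R -> X) (phi : 'rV[R]_m.+1 -> R) (eta : R),
    [/\ 0 < eta, {within @cyl_set R m, continuous h}, continuous phi,
        forall z, @stdsimplex R m z -> h (z, 0) = f z &
        [/\ forall z s, cyl_set (z, s) -> U (h (z, s)),
            forall z, @stdsimplex R m z -> depth z = 0 -> phi z = 0 &
            forall z, @stdsimplex R m z ->
              ~ (h (z, Num.min 1 (depth z / eta)) = x /\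
                 u z + phi z * Num.min 1 (depth z / eta) = 0)]].
Proof.
move=> mn cf cu fU off.
have cS := @compact_stdsimplex R m.
(* A uniform margin: points [e1]-close to the image point of [f] stay in [U]. *)
have [e1 e10 e1U] : exists2 e : R, 0 < e &
    forall z, @stdsimplex R m z -> forall y, mdist (f z) y < e -> U y.
  apply: compact_uniform => // z zS.
  have /nbhs_ballP[d /= d0 dU] : nbhs (f z) U.
    exact: (open_nbhs_nbhs (conj openU (fU _ zS))).
  exists (d / 2); first by rewrite divr_gt0.
  have d20 : 0 < d / 2 by rewrite divr_gt0.
  have : \forall z' \near within (@stdsimplex R m) (nbhs z), ball (f z) (d / 2) (f z').
    exact: ((subspace_continuousP _ _).1 cf _ zS _ (nbhsx_ballx (f z) _ d20)).
  apply: filterS => z' zz' e _ ed y zy; apply: dU; rewrite (splitr d).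
  apply: ball_triangle zz' _; rewrite ballEmdist; exact: lt_trans ed.
(* [G] could vanish only at a boundary point sent to [(x, 0)], which is excluded; this gives the
   margin [c]. *)
pose G z := depth z + mdist (f z) x + `|u z|.
have [c c0 cG] : exists2 c : R, 0 < c & forall z, @stdsimplex R m z -> c <= G z.
  apply: compact_pos_lbound => //.
    apply/subspace_continuousP => z zS.
    apply: (@cvgD R R^o _ (within (@stdsimplex R m) (nbhs z))).
      apply: (@cvgD R R^o _ (within (@stdsimplex R m) (nbhs z))).
        apply: cvg_trans (@continuous_depth R m z).
        by apply: cvg_fmap2; exact: cvg_within.
      apply: (@cvg_comp _ _ _ f (fun y => mdist y x) _ (nbhs (f z))).
        exact: ((subspace_continuousP _ _).1 cf _ zS).
      exact: continuous_mdistl.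
    by apply: cvg_norm; exact: ((subspace_continuousP _ _).1 cu _ zS).
  move=> z zS; have d0 := depth_ge0 zS.
  rewrite /G; have [dz|dz] := eqVneq (depth z) 0; last first.
    by rewrite -addrA ltr_wpDr ?addr_ge0 ?mdist_ge0// lt_neqAle eq_sym dz.
  have := off z zS dz; rewrite dz add0r => nz.
  have [fx|fx] := eqVneq (f z) x.
    rewrite fx mdistxx add0r normr_gt0; apply/eqP => u0; exact: nz.
  by rewrite ltr_wpDr// mdist_gt0.
pose e := Num.min e1 (c / 4).
have e0 : 0 < e by rewrite lt_min e10 divr_gt0.
have [h [ch h0 hd hs]] := AP_simplex APX mn e0 cf.
have hU z s : cyl_set (z, s) -> U (h (z, s)).
  move=> [zS]; rewrite /= in_itv/= => s01; apply: (e1U _ zS).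
  by apply: lt_le_trans (hd _ _ zS s01) _; rewrite ge_min lexx.
(* Of the margin [c], the depth uses at most [c / 2] and the distance from [f z] to [x] less than
   [c / 4]; the rest is left for [u]. So in the collar of depth [c / 2] no stage of the homotopy
   meets [(x, 0)] while [u] is unchanged. *)
have near_u z s : cyl_set (z, s) -> depth z <= c / 2 -> h (z, s) = x -> c / 4 < `|u z|.
  move=> [zS]; rewrite /= in_itv/= => s01 zc hx.
  have := cG _ zS; have := hd _ _ zS s01; rewrite hx /G /e lt_min => /andP[_].
  lra.
have c40 : 0 < c / 4 by rewrite divr_gt0.
have [C0 [C1 [cC0 cC1 C01 hC [C0u C1u]]]] := hs x u _ c40 cu.
(* The bump has to vanish where [u] is nonzero already and on the collar. [C0] misses the first by
   the splitting and the second by [near_u]. *)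
pose B := C1 `|` (@stdsimplex R m `&` [set z | depth z <= c / 2]).
have cB : closed B.
  apply: closedU => //; apply: closedI; first exact: closed_stdsimplex.
  apply: (@closed_comp _ _ (@depth R m) [set a | a <= c / 2]) => [z _|].
    exact: continuous_depth.
  exact: closed_le.
have BC0 : B `&` C0 = set0.
  rewrite -subset0 => z [[C1z|[zS zc]] C0z].
    by have : (C0 `&` C1) z by []; rewrite C01.
  have [_ hx] := C0u _ C0z; have zC : cyl_set (z, 1).
    by split=> //=; rewrite in_itv/= ler01 lexx.
  by have := near_u z 1 zC zc hx; move=> /lt_trans h1 /h1; rewrite ltxx.
have sepB : uniform_separator B C0.
  by apply: (iffLR (@normal_separatorP R _)) => //; exact: pseudometric_normal.
pose phi0 : 'rV[R]_m.+1 -> R := Urysohn B C0.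
have phiB z : B z -> phi0 z = 0.
  by move=> Bz; apply: (Urysohn_sub0 sepB); exists z.
have phiC z : C0 z -> phi0 z = 1.
  by move=> Cz; apply: (Urysohn_sub1 sepB); exists z.
(* The height [c / 2] exceeds the bound [c / 4] of [|u|] on [C0], so the sum is positive there. With
   [eta = c / 2] the homotopy is complete wherever the depth exceeds that of the collar. *)
exists h, (fun z => c / 2 * phi0 z), (c / 2); split => //.
- by rewrite divr_gt0.
- by move=> z; apply: (@cvgMr R _ (nbhs z)); exact: Urysohn_continuous.
split=> //.
  by move=> z zS dz; rewrite phiB ?mulr0//; right; split=> //=; rewrite dz divr_ge0 ?ltW.
move=> z zS [hx]; have d0 := depth_ge0 zS.
have c20 : 0 < c / 2 by rewrite divr_gt0.
have [zc|zc] := leP (depth z) (c / 2).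
  rewrite phiB ?mulr0 ?mul0r ?addr0; last by right.
  move=> u0; have zC : cyl_set (z, Num.min 1 (depth z / (c / 2))).
    split=> //=; rewrite in_itv/= ge_min lexx/= le_min ler01/=.
    by rewrite divr_ge0// ltW.
  by have := near_u _ _ zC zc hx; rewrite u0 normr0 => /(lt_trans c40); rewrite ltxx.
have minE : Num.min 1 (depth z / (c / 2)) = 1.
  by rewrite min_l// ler_pdivlMr// mul1r ltW.
move: hx; rewrite minE mulr1 => hx; case: (hC _ zS hx) => Cz.
  have [_ _] := C0u _ Cz; rewrite phiC// ltr_norml => /andP[ul _]; lra.
by rewrite phiB; [rewrite mulr0 addr0; apply/eqP; exact: C1u|left].
Qed.

End PushOff.

(** * Homotopy extension with end in [susp_minus] *)

Section Compression.
Variables (R : realType) (X : metricType R) (n : nat) (x : X) (U : set X).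
Hypothesis APX : AP_n0 X n.
Hypothesis openU : open U.

Local Notation V := (X * R)%type.
Local Notation sV := (@susp R X U).
Local Notation sW := (@susp_minus R X x U).

(** [K] is extended through [hep_retract], but the end of this extension may hit [(x, 0)] inside the
    simplex. A second phase, [push_off], corrects it and is timed so as never to start over the
    boundary. *)
Lemma compress_extension m (K : 'rV[R]_m.+1 * R -> V) : (m <= n)%N ->
  {within @cyl_bdry R m, continuous K} ->
  (forall zs, cyl_bdry zs -> sV (K zs)) ->
  (forall z i, @stdsimplex R m z -> z ord0 i = 0 -> sW (K (z, 1))) ->
  exists H : 'rV[R]_m.+1 * R -> V,
    [/\ {within @cyl_set R m, continuous H},
        forall zs, cyl_set zs -> sV (H zs),
        forall zs, cyl_bdry zs -> H zs = K zs &
        forall z, @stdsimplex R m z -> sW (H (z, 1))].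
Proof.
move=> mn cK KV KW.
pose P := K \o @hep_retract R m.
have cP : {within @cyl_set R m, continuous P}.
  by apply: (within_comp (@continuous_hep_retract R m) _ cK) => zs; exact: hep_retract_bdry.
have PV zs : cyl_set zs -> sV (P zs) by move=> zsC; apply: KV; exact: hep_retract_bdry.
have P0 zs : cyl_bdry zs -> P zs = K zs by move=> zsB; rewrite /P/= hep_retract_id.
have I01 (s : R) : 0 <= s <= 1 -> `[0, 1]%classic s by rewrite /= in_itv.
have in1 z : @stdsimplex R m z -> cyl_set (z, 1).
  by move=> zS; split => //; apply: I01; rewrite ler01 lexx.
have cfst1 : {within @cyl_set R m, continuous (fst \o P)}.
  by apply: within_continuous_comp cP => y _; exact: cvg_fst.
have csnd1 : {within @cyl_set R m, continuous (snd \o P)}.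
  by apply: within_continuous_comp cP => y _; exact: cvg_snd.
have cat1 : {within @stdsimplex R m, continuous (fun z : 'rV[R]_m.+1 => (z, 1 : R))}.
  apply: within_pair; apply: continuous_subspaceT => z; first exact: cvg_id.
  exact: (@cvg_cst R 1 _ (nbhs z) _).
have [||||h [phi [eta [eta0 ch cphi h0 [hU phi0 off]]]]] := @push_off R X n x U APX openU m
    (fun z => (P (z, 1)).1) (fun z => (P (z, 1)).2) mn.
- exact: within_comp cat1 in1 cfst1.
- exact: within_comp cat1 in1 csnd1.
- by move=> z /in1 /PV.
- move=> z zS /(depth_eq0 zS)[i zi] [fx u0].
  have [_] := KW z i zS zi; rewrite -P0; last by split; [exact: in1|right; exists i].
  by apply.
(* The clock of the two phases. At height [1] it reads [1 + depth]: the extension is complete and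
   the excess [depth] yields the stage [Num.min 1 (depth / eta)] required by [push_off]. Over the
   boundary it reads the height itself, so only [K] is seen. *)
pose T (zs : 'rV[R]_m.+1 * R) := zs.2 * (1 + depth zs.1).
have cT : continuous T.
  move=> zs; apply: (@cvgM R _ (nbhs zs)); first exact: cvg_snd.
  apply: (@cvgD R R^o _ (nbhs zs)); first exact: cvg_cst.
  apply: (@continuous_comp _ _ _ fst (@depth R m)); first exact: cvg_fst.
  exact: continuous_depth.
pose t1 zs := Num.min 1 (T zs).
pose t2 zs := Num.min 1 (Num.max 0 (T zs - 1) / eta).
have ct1 : continuous t1.
  by move=> zs; apply: (@cvg_minr R _ (nbhs zs)); [exact: cvg_cst|exact: cT].
have ct2 : continuous t2.
  move=> zs; apply: (@cvg_minr R _ (nbhs zs)); first exact: cvg_cst.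
  apply: (@cvgMl R _ (nbhs zs)); apply: (@cvg_maxr R _ (nbhs zs)); first exact: cvg_cst.
  by apply: (@cvgB R R^o _ (nbhs zs)); [exact: cT|exact: cvg_cst].
have T0 zs : cyl_set zs -> 0 <= T zs.
  move=> [zS]; rewrite /= in_itv/= => /andP[s0 _]; rewrite mulr_ge0// addr_ge0//.
  exact: depth_ge0.
have C1 zs : cyl_set zs -> cyl_set (zs.1, t1 zs).
  move=> /[dup] /T0 T0' [zS _]; split => //; apply: I01.
  by rewrite le_min ler01 T0'/= ge_min lexx.
have C2 zs : cyl_set zs -> cyl_set (zs.1, t2 zs).
  move=> [zS _]; split => //; apply: I01.
  rewrite le_min ler01/= ge_min lexx/= andbT.
  by apply: divr_ge0; [rewrite le_max lexx|exact: ltW].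
(* The two formulas agree at [T zs = 1], since [h] starts at the end of the extension. *)
pose F zs := if T zs <= 1 then (P (zs.1, t1 zs)).1 else h (zs.1, t2 zs).
have F1 zs : T zs <= 1 -> F zs = (P (zs.1, t1 zs)).1 by rewrite /F => ->.
have F2 zs : cyl_set zs -> 1 <= T zs -> F zs = h (zs.1, t2 zs).
  move=> [zS _] Tzs; rewrite /F; case: leP => // Tle.
  have T1 : T zs = 1 by apply/eqP; rewrite eq_le Tle.
  by rewrite /t1 /t2 T1 subrr max_l// mul0r minxx min_r// h0.
have cpair t : continuous t -> continuous (fun zs : 'rV[R]_m.+1 * R => (zs.1, t zs : R)).
  by move=> ct zs; have := cvg_pair (@cvg_fst _ _ (nbhs zs.1) (nbhs zs.2) _) (ct zs); exact.
have cF : {within @cyl_set R m, continuous F}.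
  have -> : @cyl_set R m = (@cyl_set R m `&` [set zs | T zs <= 1]) `|`
      (@cyl_set R m `&` [set zs | 1 <= T zs]).
    apply/seteqP; split=> zs; last by case=> -[].
    by move=> zsC; case/orP: (le_total (T zs) 1) => ?; [left|right].
  apply: withinU_continuous.
  - apply: closedI; first exact: closed_cyl_set.
    apply: (@closed_comp _ _ T [set a | a <= 1]) => [zs _|].
      exact: cT.
    exact: closed_le.
  - apply: closedI; first exact: closed_cyl_set.
    apply: (@closed_comp _ _ T [set a | 1 <= a]) => [zs _|].
      exact: cT.
    exact: closed_ge.
  - apply: (@subspace_eq_continuous _ _ _ ((fst \o P) \o (fun zs => (zs.1, t1 zs)))).
      by move=> zs; rewrite inE => -[_ Tzs]; apply: esym; exact: F1.
    apply: (within_comp _ _ cfst1); last by move=> zs [/C1].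
    by apply: continuous_subspaceT; exact: cpair.
  - apply: (@subspace_eq_continuous _ _ _ (h \o (fun zs => (zs.1, t2 zs)))).
      by move=> zs; rewrite inE => -[zsC Tzs]; apply: esym; exact: F2.
    apply: (within_comp _ _ ch); last by move=> zs [/C2].
    by apply: continuous_subspaceT; exact: cpair.
(* A single formula suffices here: [t2] is [0] during the first phase and [t1] is [1] during the
   second. *)
pose S zs := (P (zs.1, t1 zs)).2 + phi zs.1 * t2 zs.
have cS : {within @cyl_set R m, continuous S}.
  have cS1 : {within @cyl_set R m, continuous (fun zs => (P (zs.1, t1 zs)).2)}.
    apply: (within_comp _ C1 csnd1).
    by apply: continuous_subspaceT; exact: cpair.
  have cS2 : {within @cyl_set R m, continuous (fun zs => phi zs.1 * t2 zs)}.
    apply: continuous_subspaceT => zs; apply: (@cvgM R _ (nbhs zs)); last exact: ct2.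
    by apply: (@continuous_comp _ _ _ fst phi); [exact: cvg_fst|exact: cphi].
  by move=> zs; apply: (@cvgD R R^o _ (nbhs (zs : subspace (@cyl_set R m))));
    [exact: cS1|exact: cS2].
exists (fun zs => (F zs, S zs)); split.
- exact: within_pair.
- move=> zs zsC; rewrite /susp/= /F; case: ifP => _; first exact: PV (C1 _ zsC).
  by apply: hU; exact: C2.
- move=> [z s] /[dup] zsB [zsC b]; have [zS] := zsC; rewrite /= in_itv/= => /andP[s0 s1].
  rewrite -P0//; suff [TE pE] : T (z, s) = s /\ phi z * t2 (z, s) = 0.
    have t1E : t1 (z, s) = s by rewrite /t1 TE min_r.
    by rewrite F1 ?TE// /S /= pE addr0 t1E -surjective_pairing.
  case: b => /= [s0'|[i zi]].
    by rewrite /t2 /T/= s0' mul0r sub0r max_l ?oppr_le0// mul0r min_r// mulr0.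
  have dz : depth z = 0 by rewrite /depth (low_eq0 zS zi) mulr0.
  by rewrite phi0// mul0r /T/= dz addr0 mulr1.
- move=> z zS; have d0 := depth_ge0 zS.
  have TE : T (z, 1) = 1 + depth z by rewrite /T/= mul1r.
  have T1 : 1 <= T (z, 1) by rewrite TE lerDl.
  have t1E : t1 (z, 1) = 1 by rewrite /t1 min_l.
  have t2E : t2 (z, 1) = Num.min 1 (depth z / eta).
    by rewrite /t2 TE (addrC 1) addrK max_r.
  have zC := in1 _ zS; split => /=; first by rewrite F2//; apply: hU; exact: C2.
  by rewrite F2// /S/= t1E t2E; exact: off.
Qed.

End Compression.

(** * Compressing homotopies compatible with faces *)

Section NaturalCompression.
Variables (R : realType) (X : metricType R) (n : nat) (x : X) (U : set X).
Hypothesis APX : AP_n0 X n.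
Hypothesis openU : open U.

Local Notation V := (X * R)%type.
Local Notation sV := (@susp R X U).
Local Notation sW := (@susp_minus R X x U).

Definition homotopies m := smp R V m -> 'rV[R]_m.+1 * R -> V.

(** The last clause holds simplices of [sW] still; it makes the resulting chain map the identity on
    chains of [sW]. *)
Definition compressing m (H : homotopies m) := forall s, sing_in sV s ->
  [/\ {within @cyl_set R m, continuous (H s)},
      forall zs, cyl_set zs -> sV (H s zs),
      forall z, @stdsimplex R m z -> H s (z, 0) = s z,
      forall z, @stdsimplex R m z -> sW (H s (z, 1)) &
      sing_in sW s -> forall zs, cyl_set zs -> H s zs = s zs.1].

(** The gluing condition for the homotopies of the faces of a simplex, at their common points. *)
Definition face_coherent m (H : homotopies m) :=
  forall (s : smp R V m.+1), sing_in sV s -> forall i j z z' t,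
    cyl_set (z, t) -> cyl_set (z', t) -> face_map i z = face_map j z' ->
    H (s \o face_map i) (z, t) = H (s \o face_map j) (z', t).

Definition extends_faces m (H : homotopies m) (H' : homotopies m.+1) :=
  forall (s : smp R V m.+1), sing_in sV s -> forall i z t, cyl_set (z, t) ->
    H' s (face_map i z, t) = H (s \o face_map i) (z, t).

Definition unface m (i : 'I_m.+2) (z : 'rV[R]_m.+2) : 'rV[R]_m.+1 :=
  \row_j z ord0 (lift i j).

Lemma face_mapK m (i : 'I_m.+2) : cancel (@face_map R m i) (unface i).
Proof. by move=> z; apply/rowP => j; rewrite mxE face_map_lift. Qed.

Lemma unfaceK m (i : 'I_m.+2) (z : 'rV[R]_m.+2) : z ord0 i = 0 -> face_map i (unface i z) = z.
Proof.
move=> zi; apply/rowP => j; case: (unliftP i j) => [l ->|->].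
  by rewrite face_map_lift mxE.
by rewrite face_map_diag.
Qed.

Lemma continuous_unface m (i : 'I_m.+2) : continuous (unface i).
Proof.
move=> z; apply: (@cvg_rV _ _ (nbhs z)) => j; rewrite mxE.
under eq_fun do rewrite mxE; exact: coord_continuous.
Qed.

Lemma unface_cyl m (i : 'I_m.+2) (z : 'rV[R]_m.+2) (t : R) : cyl_set (z, t) -> z ord0 i = 0 ->
  cyl_set (unface i z, t).
Proof.
move=> [zS t01] zi; split => //=; apply/(stdsimplex_face i).
by rewrite unfaceK.
Qed.

Lemma face_map_face m (i j : 'I_m.+3) (i' j' : 'I_m.+2) (y : 'rV[R]_m.+1) :
  (j < i)%N -> i = i'.+1 :> nat -> j = j' :> nat ->
  face_map i (face_map j' y) = face_map j (face_map i' y).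
Proof.
move=> ji ii' jj'.
have liftij : lift i j' = j by apply: val_inj; rewrite /= /bump; lia.
have liftji : lift j i' = i by apply: val_inj; rewrite /= /bump; lia.
apply/rowP => c; case: (unliftP i c) => [d ->|->]; last first.
  by rewrite face_map_diag -[in RHS]liftji face_map_lift face_map_diag.
rewrite face_map_lift; case: (unliftP j' d) => [l ->|->]; last first.
  by rewrite liftij !face_map_diag.
have -> : lift i (lift j' l) = lift j (lift i' l).
  by apply: val_inj; rewrite /= /bump; lia.
by rewrite !face_map_lift.
Qed.

(** Two distinct faces meet in a face of codimension two. There both sides reduce to the homotopy
    [H] of one and the same simplex, as the simplicial identity makes the two iterated faces equal
    as functions. *)
Lemma face_coherent_ext m (H : homotopies m) (H' : homotopies m.+1) :
  extends_faces H H' -> face_coherent H'.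
Proof.
move=> HH' s sVs i j z z' t.
wlog ij : i j z z' / (j <= i)%N.
  move=> W zC z'C zz'; have [ji|ij] := leqP j i; first exact: W.
  by apply: esym; apply: W => //; exact: ltnW.
move=> zC z'C zz'; move: ij; rewrite leq_eqVlt => /orP[/eqP/val_inj ji|ji].
  by subst j; rewrite -(face_mapK i z) zz' face_mapK.
have j'P : (j < m.+2)%N by apply: leq_trans ji _; rewrite -ltnS.
have i'P : (i.-1 < m.+2)%N by have := ltn_ord i; lia.
pose j' := Ordinal j'P; pose i' := Ordinal i'P.
have ii' : i = i'.+1 :> nat by rewrite /=; lia.
have liftij : lift i j' = j by apply: val_inj; rewrite /= /bump; lia.
have liftji : lift j i' = i by apply: val_inj; rewrite /= /bump; lia.
have zj : z ord0 j' = 0.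
  by rewrite -(face_map_lift i) zz' liftij face_map_diag.
have zi : z' ord0 i' = 0.
  by rewrite -(face_map_lift j) -zz' liftji face_map_diag.
have yy' : unface j' z = unface i' z'.
  apply/rowP => l; rewrite !mxE -(face_map_lift i) zz' -(face_map_lift j).
  by congr (_ _ _); apply: val_inj; rewrite /= /bump; lia.
rewrite -(unfaceK zj) -(unfaceK zi).
rewrite (HH' _ (sing_in_face i sVs)); last exact: unface_cyl.
rewrite (HH' _ (sing_in_face j sVs)); last exact: unface_cyl.
rewrite yy'; congr (H _ _); apply: funext => y /=.
by rewrite (@face_map_face _ i j i' j').
Qed.

(** For a point the lateral boundary is empty, so only the bottom is prescribed; coherence is clear
    because the two faces of a segment are disjoint. *)
Lemma compressing_base : exists H : homotopies 0, compressing H /\ face_coherent H.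
Proof.
have bdry0 (z : 'rV[R]_1) i : @stdsimplex R 0 z -> z ord0 i = 1.
  by move=> [_]; rewrite big_ord1 (ord1 i).
have H_exists (s : smp R V 0) : exists Hs : 'rV[R]_1 * R -> V, sing_in sV s ->
    [/\ {within @cyl_set R 0, continuous Hs},
      forall zs, cyl_set zs -> sV (Hs zs),
      forall z, @stdsimplex R 0 z -> Hs (z, 0) = s z,
      forall z, @stdsimplex R 0 z -> sW (Hs (z, 1)) &
      sing_in sW s -> forall zs, cyl_set zs -> Hs zs = s zs.1].
  have cfst (A : set ('rV[R]_1 * R)) : {within A, continuous (fun zs => zs.1)}.
    by apply: continuous_subspaceT => zs; exact: cvg_fst.
  have [sWs|nsW] := pselect (sing_in sW s).
    exists (fun zs => s zs.1) => sVs; split => //.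
    - by apply: (within_comp _ _ sWs.1) => [|zs []]; first exact: cfst.
    - by move=> zs [zS _]; apply: sVs.2; exists zs.1.
    - by move=> z zS; apply: sWs.2; exists z.
  have [sVs|] := pselect (sing_in sV s); last by exists (fun zs => s zs.1).
  have [|||H [cH HV HK HW]] := @compress_extension R X n x U APX openU 0
      (fun zs => s zs.1) (leq0n n).
  - by apply: (within_comp _ _ sVs.1) => [|zs [[]]]; first exact: cfst.
  - by move=> zs [[zS _] _]; apply: sVs.2; exists zs.1.
  - by move=> z i zS zi; have := bdry0 z i zS; rewrite zi => /esym/eqP; rewrite oner_eq0.
  exists H => _; split => // z zS; rewrite HK//; split; last by left.
  by split => //=; rewrite in_itv/= lexx ler01.
have [H HP] := choice H_exists.
exists H; split=> [s sVs|s sVs i j z z' t [zS _] [z'S _] zz']; first exact: HP.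
have [ij|ij] := eqVneq i j.
  by subst j; rewrite -(face_mapK i z) zz' face_mapK.
case: (unliftP i j) => [l jl|ji]; last by rewrite ji eqxx in ij.
have := face_map_lift i z l; rewrite zz' -jl face_map_diag bdry0// => /eqP.
by rewrite eq_sym oner_eq0.
Qed.

Lemma compressing_step m (H : homotopies m) : (m.+1 <= n)%N ->
  compressing H -> face_coherent H ->
  exists H' : homotopies m.+1, compressing H' /\ extends_faces H H'.
Proof.
move=> mn Hc Hf.
have K_exists (s : smp R V m.+1) : sing_in sV s ->
  exists K : 'rV[R]_m.+2 * R -> V,
   [/\ {within @cyl_bdry R m.+1, continuous K},
       forall zs, cyl_bdry zs -> sV (K zs),
       forall z, @stdsimplex R m.+1 z -> K (z, 0) = s z &
       forall i z t, cyl_set (z, t) -> K (face_map i z, t) = H (s \o face_map i) (z, t)].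
  move=> sVs.
  (* Any vanishing coordinate may be picked, the value being the same by [Hf]. The default branch
     concerns the bottom over interior points. *)
  pose K (zs : 'rV[R]_m.+2 * R) :=
    if [pick i | zs.1 ord0 i == 0] is Some i
    then H (s \o face_map i) (unface i zs.1, zs.2) else s zs.1.
  have KF i zs : cyl_set zs -> zs.1 ord0 i = 0 ->
      K zs = H (s \o face_map i) (unface i zs.1, zs.2).
    case: zs => z t zC /= zi; rewrite /K/=; case: pickP => [j /eqP zj|/(_ i)]; last first.
      by rewrite zi eqxx.
    by apply: Hf => //; rewrite ?unfaceK//; exact: unface_cyl.
  have K0 z : @stdsimplex R m.+1 z -> K (z, 0) = s z.
    move=> zS; rewrite /K/=; case: pickP => [j /eqP zj|//].
    have [_ _ H0 _ _] := Hc _ (sing_in_face j sVs).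
    rewrite H0 /= ?unfaceK//; apply/(stdsimplex_face j); by rewrite unfaceK.
  pose Fc i := @cyl_set R m.+1 `&` [set zs : 'rV[R]_m.+2 * R | zs.1 ord0 i = 0].
  exists K; split => //.
  - have -> : @cyl_bdry R m.+1 = (@stdsimplex R m.+1 `*` [set 0]) `|`
        \big[setU/set0]_i Fc i.
      apply/seteqP; split=> [[z t] [zC [/= t0|[i zi]]]|[z t]].
      + by left; case: zC.
      + by right; rewrite -bigcup_seq; exists i => //=; rewrite mem_index_enum.
      + case=> [[/= zS ->]|].
          by split; [split => //=; rewrite in_itv/= lexx ler01|left].
        by rewrite -bigcup_seq => -[i _ [zC zi]]; split=> //; right; exists i.
    have cA : closed (@stdsimplex R m.+1 `*` [set (0 : R)]).
      have -> : @stdsimplex R m.+1 `*` [set (0 : R)] =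
          fst @^-1` (@stdsimplex R m.+1) `&` snd @^-1` [set (0 : R)].
        by apply/seteqP; split=> zs [].
      apply: closedI.
        by apply: closed_comp => [zs _|]; [exact: cvg_fst|exact: closed_stdsimplex].
      by apply: closed_comp => [zs _|]; [exact: cvg_snd|exact: closed_eq].
    have cF i : closed (Fc i).
      apply: closedI; first exact: closed_cyl_set.
      apply: (@closed_comp _ _ (fun zs : 'rV[R]_m.+2 * R => zs.1 ord0 i) [set a | a = 0]).
        move=> zs _; apply: (@continuous_comp _ _ _ fst (fun z : 'rV[R]_m.+2 => z ord0 i)).
          exact: cvg_fst.
        exact: coord_continuous.
      exact: closed_eq.
    suff [] : closed ((@stdsimplex R m.+1 `*` [set 0]) `|`
          \big[setU/set0]_i Fc i) /\
        {within (@stdsimplex R m.+1 `*` [set 0]) `|`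
          \big[setU/set0]_i Fc i,
          continuous K} by [].
    (* The faces are glued on one at a time; closedness of the union is carried along because the
       gluing of continuous maps requires it. *)
    elim: (index_enum _) => [|i r [IHc IH]].
      rewrite big_nil setU0; split => //.
      apply: (@subspace_eq_continuous _ _ _ (s \o fst)).
        by move=> [z t]; rewrite inE => -[zS /= ->]; apply: esym; exact: K0.
      apply: (within_comp _ _ sVs.1) => [|zs []//].
      by apply: continuous_subspaceT => zs; exact: cvg_fst.
    rewrite big_cons setUCA; split; first exact: closedU.
    apply: withinU_continuous => //.
    have [cH _ _ _ _] := Hc _ (sing_in_face i sVs).
    apply: (@subspace_eq_continuous _ _ _
        (H (s \o face_map i) \o (fun zs => (unface i zs.1, zs.2)))).
      by move=> zs; rewrite inE => -[zC zi]; apply: esym; exact: KF.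
    apply: (within_comp _ _ cH); last by move=> [z t] [zC zi]; exact: unface_cyl.
    apply: within_pair; apply: continuous_subspaceT => zs; last exact: cvg_snd.
    apply: (@continuous_comp _ _ _ fst (@unface m i)); first exact: cvg_fst.
    exact: continuous_unface.
  - move=> [z t] [zC [/= t0|[i zi]]].
      case: zC => zS _; rewrite t0 K0//; apply: (sVs.2); by exists z.
    rewrite (KF i)//; have [_ HV _ _ _] := Hc _ (sing_in_face i sVs).
    by apply: HV; exact: unface_cyl.
  - move=> i z t [zS t01]; rewrite (KF i) /= ?face_mapK ?face_map_diag//.
    by split => //; exact/stdsimplex_face.
have H'_exists (s : smp R V m.+1) : exists H's : 'rV[R]_m.+2 * R -> V,
    sing_in sV s ->
    [/\ {within @cyl_set R m.+1, continuous H's},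
      forall zs, cyl_set zs -> sV (H's zs),
      forall z, @stdsimplex R m.+1 z -> H's (z, 0) = s z,
      forall z, @stdsimplex R m.+1 z -> sW (H's (z, 1)) &
      (sing_in sW s -> forall zs, cyl_set zs -> H's zs = s zs.1) /\
      forall i z t, cyl_set (z, t) -> H's (face_map i z, t) = H (s \o face_map i) (z, t)].
  (* The stationary homotopy is forced here. It extends those of the faces, which lie in [sW] too
     and are stationary by [Hid]. *)
  have [sWs|nsW] := pselect (sing_in sW s).
    exists (fun zs => s zs.1) => sVs; split => //.
    - apply: (within_comp _ _ sWs.1); last by move=> zs [].
      by apply: continuous_subspaceT => zs; exact: cvg_fst.
    - by move=> zs [zS _]; apply: sVs.2; exists zs.1.
    - by move=> z zS; apply: sWs.2; exists z.
    - split=> // i z t zC; have [_ _ _ _ Hid] := Hc _ (sing_in_face i sVs).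
      by rewrite Hid//; exact: sing_in_face.
  have [sVs|] := pselect (sing_in sV s); last by exists (fun zs => s zs.1).
  have [K [cK KV K0 KF]] := K_exists s sVs.
  have [|H' [cH' H'V H'K H'W]] := @compress_extension R X n x U APX openU m.+1 K mn cK KV.
    move=> z i zS zi; rewrite -(unfaceK zi) KF.
      have [_ _ _ HW _] := Hc _ (sing_in_face i sVs); apply: HW.
      by apply/(stdsimplex_face i); rewrite unfaceK.
    by apply: unface_cyl => //; split => //=; rewrite in_itv/= ler01 lexx.
  exists H' => _; split => //.
    move=> z zS; rewrite H'K ?K0//; split; last by left.
    by split => //=; rewrite in_itv/= lexx ler01.
  split => // i z t zC; rewrite H'K ?KF//; split.
    by case: zC => zS t01; split => //; exact/stdsimplex_face.
  by right; exists i; rewrite face_map_diag.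
have [H' H'P] := choice H'_exists.
exists H'; split=> s sVs; first by have [? ? ? ? []] := H'P s sVs.
by have [_ _ _ _ [_]] := H'P s sVs.
Qed.

Lemma natural_compression : exists H : forall m, homotopies m,
  (forall m, (m <= n)%N -> compressing (H m)) /\
  (forall m, (m < n)%N -> extends_faces (H m) (H m.+1)).
Proof.
(* The bound on [m] is put inside the invariant so that the recursion runs through all degrees;
   above [n] any family will do. *)
pose T m := {H : homotopies m | (m <= n)%N -> compressing H /\ face_coherent H}.
have step m (H : T m) : exists H' : T m.+1,
    (m < n)%N -> extends_faces (sval H) (sval H').
  have [mn|nm] := pselect (m < n)%N; last first.
    pose K : homotopies m.+1 := fun s zs => s zs.1.
    suff vac : (m.+1 <= n)%N -> compressing K /\ face_coherent K.
      by exists (exist _ K vac).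
    by move=> /nm.
  have [Hc Hf] := proj2_sig H (ltnW mn).
  have [H' [H'c H'f]] := compressing_step mn Hc Hf.
  by exists (exist _ H' (fun _ => conj H'c (face_coherent_ext H'f))).
have [H0 [H0c H0f]] := compressing_base.
pose F := fix F m : T m := match m with
  | 0 => exist _ H0 (fun _ => conj H0c H0f)
  | m'.+1 => sval (cid (step m' (F m')))
  end.
exists (fun m => sval (F m)); split=> m mn.
  by have [] := proj2_sig (F m) mn.
exact: (proj2_sig (cid (step m (F m)))) mn.
Qed.

End NaturalCompression.

Theorem theorem6p6 (R : realType) (X : metricType R) (n : nat) :
  locally_path_connected R X -> AP_n0 X n ->
  forall (x : X) (U : set X), open U ->
  forall k : nat, (k < n)%N -> rel_homology_trivial R U (U `\ x) k.
Proof.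
move=> _ APX x U oU k kn.
have [H [Hc Hf]] := natural_compression x APX oU.
have in0 m (t : 'rV[R]_m.+1) (a : R) : 0 <= a <= 1 -> @stdsimplex R m t -> cyl_set (t, a).
  by move=> a01 tS; split => //=; rewrite in_itv.
have one01 : 0 <= (1 : R) <= 1 by rewrite ler01 lexx.
(* The chain map sends a simplex to the end of its homotopy. It is used up to degree [k.+1], which
   is at most [n]. *)
apply: (@susp_rel_homology_trivial R X x U k _ (fun m s t => H m s (t, 1))).
- by apply: accessible_closed_set1; apply: hausdorff_accessible; exact: metric_hausdorff.
- move=> m s mk sVs; have [cH _ _ HW _] := Hc m (leq_trans mk kn) _ sVs; split.
    apply: (within_comp _ _ cH); last by move=> t; exact: in0.
    apply: within_pair; apply: continuous_subspaceT => z; first exact: cvg_id.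
    exact: (@cvg_cst R 1 _ (nbhs z) _).
  by move=> _ [t tS <-]; exact: HW.
- move=> m s t mk sWs tS; have sVs : sing_in (@susp R X U) s.
    by apply: sing_in_sub sWs => y [].
  by have [_ _ _ _ ->] := Hc m (leq_trans mk kn) _ sVs; rewrite //; exact: in0.
- move=> m s i t mk sVs tS; by apply: Hf (in0 _ _ _ _ _); rewrite ?(leq_trans mk kn).
Qed.
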